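(* Let $1<p<\infty$. For every $\varepsilon>0$ there is an equivalent norm on $L_p[0,1]$ in which the Haar basis is normalized, $1$-unconditional, $1$-bidemocratic and $(1+\varepsilon)$-greedy.
   Context: $L_p[0,1]$ is the real space and the Haar basis $(e_i)_{i\in\mathbb N}$ is the Haar system (the constant function $1$ together with the functions $h_I=\mathbf 1_{I^-}-\mathbf 1_{I^+}$, $I$ a dyadic subinterval of $[0,1]$ with left and right halves $I^-$, $I^+$), in its usual order and with each function normalized in $L_p[0,1]$. $\mathbb N=\{1,2,\dots\}$. The following notions for a basis $(e_i)$ of a Banach space $X$ are taken with respect to the norm under consideration (and its dual norm). Normalized: $\|e_i\|=1$ for all $i$. $K$-unconditional: $\|\sum a_ie_i\|\le K\|\sum b_ie_i\|$ whenever $|a_i|\le|b_i|$ for all $i$. With biorthogonal functionals $(e_i^* )$, put $\varphi(n)=\sup_{|A|\le n}\|\sum_{i\in A}e_i\|$ and $\varphi^*(n)=\sup_{|A|\le n}\|\sum_{i\in A}e_i^*\|$ ($A\subset\mathbb N$ finite). $\Delta$-bidemocratic: $\varphi(n)\varphi^*(n)\le\Delta n$ for all $n\in\mathbb N$. For $x=\sum x_ie_i$ and $m\in\mathbb N$ put $\sigma_m(x)=\inf\{\|x-\sum_{i\in A}a_ie_i\|: A\subset\mathbb N,\ |A|\le m,\ (a_i)_{i\in A}\subset\mathbb R\}$. For each $x$ fix distinct indices $\rho(1),\rho(2),\dots$ (depending on $x$, not necessarily unique) such that $|x_{\rho(1)}|\ge|x_{\rho(2)}|\ge\cdots$ and,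 for every $m$, $|x_{\rho(m)}|\ge|x_i|$ for all $i\notin\{\rho(1),\dots,\rho(m)\}$; put $\mathcal G_m(x)=\sum_{i=1}^m x_{\rho(i)}e_{\rho(i)}$. $C$-greedy: $\|x-\mathcal G_m(x)\|\le C\sigma_m(x)$ for all $x\in X$, $m\in\mathbb N$. *)

(* Defs.v *)
From HB Require Import structures.
From mathcomp Require Import all_boot all_order all_algebra.
From mathcomp Require Import finmap.
From mathcomp Require Import all_classical all_reals all_analysis.
From mathcomp Require Import ess_sup_inf measurable_realfun.

Set Implicit Arguments.
Unset Strict Implicit.
Unset Printing Implicit Defensive.

Import Order.TTheory GRing.Theory Num.Theory.
Import numFieldNormedType.Exports.

Local Open Scope classical_set_scope.
Local Open Scope ring_scope.
Local Open Scope quotient_scope.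

(* The library's [LspaceType] carries no algebraic structure, so the normed
   space L_p(mu) is built here as the quotient of the vector space
   [LfunType mu p1] by the subspace of almost everywhere null functions. *)
Section Lp_quotient.
Context d (T : measurableType d) (R : realType).
Variables (mu : {measure set T -> \bar R}) (p : \bar R) (p1 : (1 <= p)%E).

Definition ae_null : {pred LfunType mu p1} :=
  fun f => `[< (f : T -> R) = cst 0 %[ae mu] >].

Lemma ae_nullP (f : LfunType mu p1) :
  reflect ((f : T -> R) = cst 0 %[ae mu]) (f \in ae_null).
Proof. exact: asboolP. Qed.

Lemma ae_null_zmod_closed : zmod_closed ae_null.
Proof.
split; first by apply/ae_nullP; apply: nearW.
move=> f g /ae_nullP f0 /ae_nullP g0; apply/ae_nullP.
move: f0 g0; apply: filterS2 => x fx gx I.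
by rewrite /= [LHS]/GRing.add /= fx// [X in 0 + X]/GRing.opp /= gx// subr0.
Qed.

HB.instance Definition _ :=
  GRing.isZmodClosed.Build (LfunType mu p1) ae_null ae_null_zmod_closed.

Definition Lp : Type := Quotient.quot ae_null.
HB.instance Definition _ := Choice.on Lp.
HB.instance Definition _ := EqQuotient.on Lp.
HB.instance Definition _ := GRing.Zmodule.on Lp.
HB.instance Definition _ := ZmodQuotient.on Lp.

Lemma Lp_eqP (f g : LfunType mu p1) :
  reflect ((f : T -> R) = g %[ae mu]) (f == g %[mod Lp]).
Proof.
rewrite -Quotient.idealrBE; apply: (iffP (ae_nullP _)); apply: filterS => x fg I.
  by apply/eqP; rewrite -subr_eq0; apply/eqP; exact: fg.
by rewrite /= [LHS]/GRing.add /= [X in _ + X]/GRing.opp /= fg// subrr.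
Qed.

Lemma ae_null_scaler_closed : GRing.scaler_closed ae_null.
Proof.
move=> a f /ae_nullP f0; apply/ae_nullP; move: f0; apply: filterS => x fx I.
by rewrite /= [LHS]/GRing.scale /= fx// [LHS]mulr0.
Qed.

Definition Lp_scale (a : R) := lift_op1 Lp ( *:%R a).

Lemma pi_Lp_scale a : {morph \pi_Lp : f / a *: f >-> Lp_scale a f}.
Proof.
move=> f; unlock Lp_scale; apply/eqP.
rewrite -Quotient.idealrBE -scalerBr ae_null_scaler_closed//.
by rewrite Quotient.idealrBE reprK.
Qed.
Canonical pi_Lp_scale_morph a := PiMorph1 (pi_Lp_scale a).

Let scaleLA a b (x : Lp) : Lp_scale a (Lp_scale b x) = Lp_scale (a * b) x.
Proof. by rewrite -[x]reprK !piE scalerA. Qed.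

Let scaleL1 : left_id 1 Lp_scale.
Proof. by move=> x; rewrite -[x]reprK !piE scale1r. Qed.

Let scaleLDr : right_distributive Lp_scale +%R.
Proof. by move=> a x y; rewrite -[x]reprK -[y]reprK !piE scalerDr. Qed.

Let scaleLDl (x : Lp) : {morph Lp_scale^~ x : a b / a + b}.
Proof. by move=> a b; rewrite /= -[x]reprK !piE scalerDl. Qed.

HB.instance Definition _ := GRing.Zmodule_isLmodule.Build R Lp
  scaleLA scaleL1 scaleLDr scaleLDl.

Lemma Lp_piZ a f : \pi_Lp (a *: f) = a *: \pi_Lp f.
Proof. exact: pi_Lp_scale. Qed.

Lemma ae_eq_Lnorm (f g : LfunType mu p1) : (f : T -> R) = g %[ae mu] ->
  'N[mu]_p[EFin \o f]%E = 'N[mu]_p[EFin \o g]%E.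
Proof.
move=> fg; rewrite unlock /Lnorm; case: p p1 f g fg => [r|//|//] r1 f g fg.
- have mX (h : LfunType mu r1) :
      measurable_fun [set: T] (fun x => `|(EFin \o h) x| `^ r)%E.
    apply: (measurableT_comp (measurable_poweR r)).
    by apply: measurableT_comp => //; exact/measurable_EFinP.
  congr (_ `^ _)%E; apply: ae_eq_integral; [by []|exact: mX|exact: mX|].
  by move: fg; apply: filterS => x fgx _ /=; rewrite fgx.
- case: ifPn => // mu0; apply: eq_ess_sup.
  by move: fg; apply: filterS => x fgx /=; rewrite fgx.
Qed.

Definition Lp_norm (x : Lp) : R :=
  fine 'N[mu]_p[EFin \o (repr x : LfunType mu p1)].

Lemma Lp_norm_pi f : Lp_norm (\pi_Lp f) = fine 'N[mu]_p[EFin \o f].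
Proof. by congr fine; apply/ae_eq_Lnorm/Lp_eqP; rewrite reprK. Qed.

Let Lp_normD x y : Lp_norm (x + y) <= Lp_norm x + Lp_norm y.
Proof.
rewrite -[x]reprK -[y]reprK -pi_addr !Lp_norm_pi.
exact: ler_LnormD.
Qed.

Let Lp_normZ a x : Lp_norm (a *: x) = `|a| * Lp_norm x.
Proof.
rewrite -[x]reprK -Lp_piZ !Lp_norm_pi.
rewrite (_ : (EFin \o _) = EFin \o (a \*: (repr x : LfunType mu p1)))//.
rewrite LnormZ fineM//.
rewrite ge0_fin_numE ?Lnorm_ge0//; exact: Lfunction_finite.
Qed.

Let Lp_norm0_eq0 x : Lp_norm x = 0 -> x = 0.
Proof.
rewrite -[x]reprK Lp_norm_pi => /fine_Lnormr_eq0 x0.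
by rewrite -[RHS](@pi_zeror _ _ _ _ _ Lp); apply/eqP/Lp_eqP.
Qed.

HB.instance Definition _ := @Lmodule_isNormed.Build R Lp Lp_norm
  Lp_normD Lp_normZ Lp_norm0_eq0.

Lemma Lp_normE (f : LfunType mu p1) :
  `|\pi_Lp f| = fine 'N[mu]_p[EFin \o f].
Proof. exact: Lp_norm_pi. Qed.

End Lp_quotient.

Section Lp01.
Variable R : realType.

Definition lebesgue01 : set (measurableTypeR R) -> \bar R :=
  mrestr lebesgue_measure (measurable_itv `[0 : R, 1]).

HB.instance Definition _ := Measure.on lebesgue01.

Let lebesgue01_fin : fin_num_fun lebesgue01.
Proof.
move=> A mA; rewrite ge0_fin_numE ?measure_ge0// /lebesgue01 /mrestr.
apply: (@le_lt_trans _ _ (lebesgue_measure `[0 : R, 1]%classic)).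
  by apply: le_measure; rewrite ?inE//; apply: measurableI.
by rewrite /= lebesgue_measure_itv /= lte_fin ltr01 -EFinB ltry.
Qed.

HB.instance Definition _ := Measure_isFinite.Build _ _ _ lebesgue01
  lebesgue01_fin.

Definition Lp01 (p : R) (p1 : 1 <= p) := @Lp _ _ R lebesgue01 p%:E (p1 : (1 <= p%:E)%E).
HB.instance Definition _ p p1 := NormedModule.on (@Lp01 p p1).

(* The index is zero-based: [haar_fun 0] is the constant 1, and for n >= 1
   written as n = 2 ^ k + j with j < 2 ^ k, [haar_fun n] is h_I for
   I = [j / 2 ^ k, (j + 1) / 2 ^ k[, so that h_[0,1] has index 1. *)
Definition haar_fun (n : nat) : measurableTypeR R -> R :=
  if n is 0 then cst 1 else
  let k := trunc_log 2 n in
  let j := (n - 2 ^ k)%N in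
  let a : R := j%:R / 2 ^+ k in
  let b : R := j.+1%:R / 2 ^+ k in
  let m : R := (a + b) / 2 in
  \1_(`[a, m[%classic) \- \1_(`[m, b[%classic).

Lemma Lfun_indic (p : R) (p1 : 1 <= p) (A : set (measurableTypeR R)) :
  measurable A -> (\1_A : measurableTypeR R -> R) \in Lfun lebesgue01 p%:E.
Proof.
move=> mA; have p0 : 0 < p by rewrite (lt_le_trans ltr01).
apply/andP; split; rewrite inE/=; first exact: measurable_indic.
rewrite /finite_norm unlock poweR_lty//.
apply: (@le_lt_trans _ _ (\int[lebesgue01]_x (cst 1 x)))%E.
  apply: ge0_le_integral => //.
  - by move=> x _; exact: poweR_ge0.
  - apply: (measurableT_comp (measurable_poweR p)).
    by apply: measurableT_comp => //; apply/measurable_EFinP/measurable_indic.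
  - move=> x _ /=; rewrite lee_fin indicE.
    by case: (x \in A); rewrite ?normr1 ?normr0 ?powR1 ?powR0 ?gt_eqF.
by rewrite integral_cst// mul1e -ge0_fin_numE// fin_num_measure.
Qed.

Lemma haar_fun_Lfun (p : R) (p1 : 1 <= p) n :
  haar_fun n \in Lfun lebesgue01 p%:E.
Proof.
case: n => [|n]; first exact: Lfun_cst.
rewrite /haar_fun; apply: rpredB; exact: Lfun_indic.
Qed.

Definition haar_class (p : R) (p1 : 1 <= p) (n : nat) : Lp01 p1 :=
  \pi_(Lp01 p1) (Lfun_Sub (p1 : (1 <= p%:E)%E) (haar_fun_Lfun p1 n)).

Definition haar (p : R) (p1 : 1 <= p) (n : nat) : Lp01 p1 :=
  `|haar_class p1 n|^-1 *: haar_class p1 n.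

End Lp01.

Section bases.
Variables (R : realType) (X : lmodType R).
Implicit Types (N : X -> R) (e : nat -> X) (a b : nat -> R) (x y : X).

Definition is_norm N :=
  [/\ forall x y, N (x + y) <= N x + N y,
      forall c x, N (c *: x) = `|c| * N x
    & forall x, N x = 0 -> x = 0].

Definition is_sum N e a x :=
  N (x - \sum_(i < n) a i *: e i) @[n --> \oo] --> (0 : R).

Definition schauder_basis N e := forall x, exists! a, is_sum N e a x.

(* [biorth N e i] is the functional e_i^* when [e] is a basis for [N]. *)
Definition biorth N e (i : nat) : X -> R :=
  fun x => xget (cst 0) (is_sum N e ^~ x) i.

Definition normalized N e := forall i, N (e i) = 1.

Definition unconditional (K : R) N e := forall a b x y,
  is_sum N e a x -> is_sum N e b y ->
  (forall i, `|a i| <= `|b i|) -> N x <= K * N y.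

Definition dual_norm N (f : X -> R) : \bar R :=
  ereal_sup [set `|f x|%:E | x in [set x | N x <= 1]].

Definition fundamental N e (n : nat) : \bar R :=
  ereal_sup [set (N (\sum_(i <- A) e i))%:E
            | A in [set A : {fset nat} | (#|` A| <= n)%N]].

Definition dual_fundamental N e (n : nat) : \bar R :=
  ereal_sup [set dual_norm N (fun x => \sum_(i <- A) biorth N e i x)
            | A in [set A : {fset nat} | (#|` A| <= n)%N]].

Definition bidemocratic (Delta : R) N e := forall n, (0 < n)%N ->
  (fundamental N e n * dual_fundamental N e n <= Delta%:E * n%:R%:E)%E.

Definition best_error N e (m : nat) x : R :=
  inf [set r | exists (A : {fset nat}) a,
        (#|` A| <= m)%N /\ r = N (x - \sum_(i <- A) a i *: e i)].

(* zero-based: [rho k] is the index of the (k+1)-th selected coefficient *)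
Definition greedy_ordering a (rho : nat -> nat) :=
  [/\ injective rho,
      forall k, `|a (rho k.+1)| <= `|a (rho k)|
    & forall k i, (forall l, (l <= k)%N -> i <> rho l) ->
        `|a i| <= `|a (rho k)|].

Definition greedy_sum N e (rho : nat -> nat) (m : nat) x : X :=
  \sum_(k < m) biorth N e (rho k) x *: e (rho k).

(* quantified over every admissible greedy ordering of each vector, so that
   the property does not depend on how ties are broken *)
Definition greedy (C : R) N e := forall x rho,
  greedy_ordering (fun i => biorth N e i x) rho ->
  forall m, (0 < m)%N -> N (x - greedy_sum N e rho m x) <= C * best_error N e m x.

End bases.

Definition equivalent_norm (R : realType) (X : normedModType R) (N : X -> R) :=
  is_norm N /\
  exists c C : R, [/\ 0 < c, 0 < C & forall x, c * `|x| <= N x <= C * `|x| ].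

(* Main.v *)
Require Import Defs.
From mathcomp Require Import all_boot all_order all_algebra.
From mathcomp Require Import finmap.
From mathcomp Require Import all_classical all_reals all_analysis.
From mathcomp Require Import measurable_realfun.
From mathcomp Require Import ring lra zify.

(** Write [x_i] for the coefficients of [x] in the normalized Haar basis [e_i],
    let [1/p + 1/q = 1], and put

      [M x = sup_A |A|^(-1/q) * sum_(i in A) |x_i|]      (finite sets [A]),
      [u x = sup |sum_(i < n) l_i x_i e_i|]     ([n] and multipliers [|l_i| <= 1]).

    The norm is [N = max (M, delta * u)] with [delta] small.  It is governed by
    four properties of the basis, with constants [K] and [C]: unconditionality,
    density of the span, the upper estimate [|sum_A b_i e_i| <= C |A|^(1/p)] for
    [|b_i| <= 1], and the lower estimate
    [sum_A |b_i| <= C |A|^(1/q) |sum_i b_i e_i|].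

    - The lower estimate says [M <= C |.|], and unconditionality says
      [|.| <= u <= K |.|]; so [N] is an equivalent norm, and it is 1-unconditional
      by its form.
    - [M] takes the value [|A|^(1/p)] on [sum_A e_i].  If [delta * C <= 1], the
      upper estimate bounds [delta * u] there by the same number, so the
      fundamental function of [N] is [n^(1/p)].  Since [N >= M], the functional
      [sum_A e_i^*] has dual norm at most [|A|^(1/q)].  The product is exactly [n].
    - Let [G] be a greedy set of [x], let [t] be the least modulus on [G], and let
      [y] be supported on [A] with [|A| <= |G|].  Passing from [x - y] to the greedy
      remainder erases the coefficients on [G \ A], which are at least [t], and
      replaces those on [A \ G] by coefficients at most [t].  As [M] is invariant under
      rearrangement it does not grow, while [u] grows by at most
      [C t |A \ G|^(1/p) <= C t |G \ A|^(1/p) <= C * M (x - y)].  Hence [N] grows by a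
      factor at most [1 + delta * C] ([new_norm_swap]).

    For the Haar system these properties are read off the dyadic tree: a sum of
    the first [2^m] Haar functions is constant on the dyadic intervals of length
    [2^-m], and the [p]-th power of its norm is the average over the tree of the
    [p]-th powers of these values ([norm_haar_sum]).  Unconditionality is
    Burkholder's martingale transform argument: a function [U] concave along both
    diagonal directions satisfies [|y|^p <= 2 U(x,y) + c |x|^p], and its average over the
    values of a Haar sum and of its transform decreases from one generation to the
    next ([sign_transform_le]).  The upper estimate holds because the normalizing
    factors grow geometrically along a branch ([node_value_upper]); the lower
    estimate follows by pairing with a flat Haar sum in [L_q] ([level_avg_lower]).
    Density comes from the dyadic intervals, Dynkin's theorem and approximation by
    simple functions ([haar_dense]). *)

Set Implicit Arguments.
Unset Strict Implicit.
Unset Printing Implicit Defensive.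

Import Order.TTheory GRing.Theory Num.Theory.
Import numFieldNormedType.Exports.
Import HBSimple HBNNSimple.

Local Open Scope classical_set_scope.
Local Open Scope ring_scope.
Local Open Scope quotient_scope.

(** * Burkholder's function *)
Section zigzag.
Variables (R : realType) (p beta : R).
Hypothesis p1 : 1 < p.
Hypothesis beta_slope : (beta + 1) * `|p - 2| <= (beta - 1) * p.
Hypothesis b1 : 1 <= beta.

(** The special function of Burkholder's martingale transform inequality;
    the sharp constant is [beta = max (p - 1) (p - 1)^-1], and every [beta]
    satisfying [beta_slope] keeps it concave along the diagonals. *)
Definition burkholder (x y : R) : R :=
  (`|x| + `|y|) `^ (p - 1) * (`|y| - beta * `|x|).

(** On the line [x - y = 1], with [s = x + y], twice [burkholder x y] equals
    [branch 1 s] for [s >= 1] and [branch (-1) (- s)] for [s <= -1], and is affine in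
    between; see [profile]. *)
Definition branch (sg t : R) : R :=
  (1 - beta) * t `^ p - sg * (1 + beta) * t `^ (p - 1).

Definition branch_slope (sg t : R) : R :=
  (beta - 1) * p * t `^ (p - 1) + sg * (1 + beta) * (p - 1) * t `^ (p - 2).

Lemma is_derive_branch (sg t : R) : 0 < t ->
  is_derive t 1 (branch sg) (- branch_slope sg t).
Proof.
move=> t0; rewrite /branch /branch_slope.
have d1 := @is_derive1_powR R p t t0.
have d2 := @is_derive1_powR R (p - 1) t t0.
apply: is_derive_eq.
rewrite (_ : p - 1 - 1 = p - 2); last by ring.
rewrite /GRing.scale /=; ring.
Qed.

Lemma is_derive_branch_slope (sg t : R) : 0 < t ->
  is_derive t 1 (branch_slope sg)
   ((p - 1) * t `^ (p - 3) * ((beta - 1) * p * t + sg * (1 + beta) * (p - 2))).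
Proof.
move=> t0; rewrite /branch_slope.
have d1 := @is_derive1_powR R (p - 1) t t0.
have d2 := @is_derive1_powR R (p - 2) t t0.
apply: is_derive_eq.
rewrite (_ : p - 1 - 1 = (p - 3) + 1); last by ring.
rewrite (_ : p - 2 - 1 = p - 3); last by ring.
rewrite powRD; last by rewrite (gt_eqF t0) implybT.
rewrite (powRr1 (ltW t0)) /GRing.scale /=; ring.
Qed.

Lemma MVT_ge (f df : R -> R) (a b : R) : a < b ->
  (forall x : R, a <= x -> is_derive x 1 f (df x)) ->
  exists2 c, a < c < b & f b - f a = df c * (b - a).
Proof.
move=> ab h.
have cf : {within `[a, b], continuous f}.
  apply: derivable_within_continuous => x.
  by rewrite in_itv /= => /andP[ax _]; have := h _ ax => -[].
have [|c] := @MVT _ f df _ _ ab _ cf.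
  by move=> x; rewrite in_itv /= => /andP[/ltW/h ax _]; exact: ax.
by rewrite in_itv /= => cab E; exists c.
Qed.

(** The derivative of [branch_slope] has the sign of
    [(beta - 1) p t +- (1 + beta) (p - 2)], which [beta_slope] makes nonnegative for [t >= 1]. *)
Lemma branch_slope_mono (sg s t : R) : `|sg| = 1 -> 1 <= s -> s <= t ->
  branch_slope sg s <= branch_slope sg t.
Proof.
move=> sg1 s1; rewrite le_eqVlt => /predU1P[->//|st].
have h (x : R) : s <= x -> is_derive x 1 (branch_slope sg) _ :=
  fun h => is_derive_branch_slope sg (lt_le_trans ltr01 (le_trans s1 h)).
have [c /andP[/ltW sc _] E] := MVT_ge st h; rewrite -subr_ge0 E.
apply: mulr_ge0; last by rewrite subr_ge0 ltW.
apply: mulr_ge0; first by rewrite mulr_ge0 ?powR_ge0// subr_ge0 ltW.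
have c1 : 1 <= c by apply: le_trans sc.
have : `|sg * (1 + beta) * (p - 2)| <= (beta - 1) * p * c.
  rewrite !normrM sg1 mul1r ger0_norm ?(addr_ge0 _ (le_trans ler01 b1))//.
  rewrite (addrC 1) (le_trans beta_slope)// ler_peMr// mulr_ge0 ?subr_ge0//.
  by rewrite (le_trans ler01) ?ltW.
by rewrite ler_norml => /andP[+ _]; rewrite -subr_ge0 opprK addrC.
Qed.

Definition profile (s : R) : R :=
  if 1 <= s then branch 1 s else if s <= -1 then branch (-1) (- s)
  else (1 - beta) - (1 + beta) * s.

Definition profile_slope (s : R) : R :=
  if 1 < s then - branch_slope 1 s else if s < -1 then branch_slope (-1) (- s)
  else - (1 + beta).

(** At the two kinks [beta_slope] also gives the right order between the outer
    slopes and the slope of the affine part. *)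
Lemma branch_slope1 sg : `|sg| = 1 -> - sg * (- (1 + beta)) <= branch_slope sg 1.
Proof.
move=> sg1; rewrite /branch_slope !powR1 !mulr1 mulNr mulrN opprK -subr_ge0.
have : `|sg * (1 + beta) * (p - 2)| <= (beta - 1) * p.
  rewrite !normrM sg1 mul1r ger0_norm ?(addr_ge0 _ (le_trans ler01 b1))//.
  by rewrite (addrC 1) (le_trans beta_slope).
rewrite ler_norml => /andP[+ _]; rewrite -subr_ge0.
by congr (0 <= _); ring.
Qed.

Lemma profile_slope_anti s t : s <= t -> profile_slope t <= profile_slope s.
Proof.
move=> st; rewrite /profile_slope.
have hp u : 1 <= u -> 1 + beta <= branch_slope 1 u.
  move=> u1; apply: le_trans (branch_slope_mono (normr1 _) (lexx _) u1).
  by have := branch_slope1 (normr1 R); rewrite mulrN mulNr opprK mul1r.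
have hm u : 1 <= u -> - (1 + beta) <= branch_slope (-1) u.
  have n1 : `|-1 : R| = 1 by rewrite normrN normr1.
  move=> u1; apply: le_trans (branch_slope_mono n1 (lexx _) u1).
  by have := branch_slope1 n1; rewrite opprK mul1r.
case: (ltP 1 t) => t1.
  case: (ltP 1 s) => s1.
    by rewrite lerN2 branch_slope_mono ?normr1// ltW.
  case: ltP => s2; last by rewrite lerN2 hp// ltW.
  apply: (@le_trans _ _ (- (1 + beta))); first by rewrite lerN2 hp// ltW.
  by rewrite hm//; lra.
rewrite (ltNge 1 s) (le_trans st t1) /=.
case: (ltP t (-1)) => t2.
  rewrite (le_lt_trans st t2) branch_slope_mono ?normrN1//; lra.
case: ltP => s2//; apply: hm; lra.
Qed.

(** Secant slopes lie between the values of the decreasing function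
    [profile_slope].  Unlike a bound on derivatives, this property can be glued
    across the kinks of the profile ([slope_bounds_trans]). *)
Definition slope_bounds a b := profile_slope b * (b - a) <= profile b - profile a /\
  profile b - profile a <= profile_slope a * (b - a).

Lemma slope_bounds_trans a b c : a <= b -> b <= c -> slope_bounds a b -> slope_bounds b c ->
  slope_bounds a c.
Proof.
move=> ab bc [h1 h2] [h3 h4].
have := profile_slope_anti ab; have := profile_slope_anti bc => s1 s2.
split.
- have : profile_slope c * (b - a) <= profile_slope b * (b - a) by rewrite ler_wpM2r// subr_ge0.
  lra.
- have : profile_slope b * (c - b) <= profile_slope a * (c - b) by rewrite ler_wpM2r// subr_ge0.
  lra.
Qed.

Lemma slope_boundsP a b : a <= b ->
  (exists2 c, a <= c <= b & profile b - profile a = profile_slope c * (b - a)) ->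
  slope_bounds a b.
Proof.
move=> ab [c /andP[ac cb] E]; rewrite /slope_bounds E.
by split; apply: ler_wpM2r; rewrite ?subr_ge0// profile_slope_anti.
Qed.

Lemma profile_mid s : -1 <= s <= 1 -> profile s = (1 - beta) - (1 + beta) * s.
Proof.
move=> /andP[s1 s2]; rewrite /profile; case: leP => [s3|_].
  have -> : s = 1 by lra.
  by rewrite /branch !powR1; ring.
case: leP => // s3; have -> : s = -1 by lra.
by rewrite opprK /branch !powR1; ring.
Qed.

Lemma profile_right s : 1 <= s -> profile s = branch 1 s.
Proof. by rewrite /profile => ->. Qed.

Lemma profile_left s : s <= -1 -> profile s = branch (-1) (- s).
Proof.
move=> s1; rewrite /profile s1; case: leP => //; lra.
Qed.

Lemma slope_bounds_right a b : 1 <= a -> a <= b -> slope_bounds a b.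
Proof.
move=> a1; rewrite le_eqVlt => /predU1P[->|ab].
  by rewrite /slope_bounds !subrr !mulr0.
apply: slope_boundsP (ltW ab) _.
have h (x : R) : a <= x -> is_derive x 1 (branch 1) _ :=
  fun h => is_derive_branch 1 (lt_le_trans ltr01 (le_trans a1 h)).
have [c /andP[ac cb] E] := MVT_ge ab h.
exists c; first by rewrite !ltW.
rewrite !profile_right ?(le_trans a1 (ltW ab))// E /profile_slope.
by rewrite (le_lt_trans a1 ac).
Qed.

Lemma slope_bounds_left a b : b <= -1 -> a <= b -> slope_bounds a b.
Proof.
move=> b1'; rewrite le_eqVlt => /predU1P[->|ab].
  by rewrite /slope_bounds !subrr !mulr0.
apply: slope_boundsP (ltW ab) _.
have nb1 : 1 <= - b by lra.
have nab : - b < - a by lra.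
have h (x : R) : - b <= x -> is_derive x 1 (branch (-1)) _ :=
  fun h => is_derive_branch (-1) (lt_le_trans ltr01 (le_trans nb1 h)).
have [c /andP[ac cb] E] := MVT_ge nab h.
exists (- c); first by lra.
rewrite !profile_left ?(le_trans (ltW ab) b1')// /profile_slope.
rewrite ifF; last by apply/negbTE; rewrite -leNgt; lra.
rewrite ifT ?opprK; last by lra.
by move: E; lra.
Qed.

Lemma slope_bounds_mid a b : -1 <= a -> b <= 1 -> a <= b -> slope_bounds a b.
Proof.
move=> a1 b1' ab; apply: slope_boundsP => //; exists a; first by rewrite lexx.
have -> : profile_slope a = - (1 + beta).
  by rewrite /profile_slope !ltNge a1 (le_trans ab b1').
by rewrite !profile_mid ?a1 ?b1' ?(le_trans ab b1') ?(le_trans a1 ab)//; ring.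
Qed.

Lemma slope_boundsT a b : a <= b -> slope_bounds a b.
Proof.
move=> ab.
have hr a' b' : -1 <= a' -> a' <= b' -> slope_bounds a' b'.
  move=> a1 ab'; have [b1'|b1'] := leP b' 1; first exact: slope_bounds_mid.
  have [a2|a2] := leP a' 1; last by apply: slope_bounds_right => //; exact: ltW.
  apply: (@slope_bounds_trans _ 1) => //; first exact: ltW.
    exact: slope_bounds_mid.
  by apply: slope_bounds_right => //; exact: ltW.
have [a1|a1] := leP (-1) a; first exact: hr.
have [b1'|b1'] := leP b (-1); first exact: slope_bounds_left.
apply: (@slope_bounds_trans _ (-1)); [exact: ltW|exact: ltW| |].
  by apply: slope_bounds_left => //; exact: ltW.
by apply: hr => //; exact: ltW.
Qed.

(** The two secants on either side of [t] are compared with [profile_slope t]. *)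
Lemma profile_midconcave t a : profile (t + a) + profile (t - a) <= 2 * profile t.
Proof.
wlog a0 : a / 0 <= a.
  move=> h; have [/h//|a0] := leP 0 a.
  by have := h (- a); rewrite opprK addrC; apply; lra.
have [|_ h1] := @slope_boundsT t (t + a); first lra.
have [|h2 _] := @slope_boundsT (t - a) t; first lra.
have E1 : t + a - t = a by ring.
have E2 : t - (t - a) = a by ring.
by move: h1 h2; rewrite E1 E2; lra.
Qed.

Lemma burkholderZ c x y : burkholder (c * x) (c * y) = `|c| `^ p * burkholder x y.
Proof.
rewrite /burkholder !normrM -mulrDr powRM ?addr_ge0//.
have p0 : 0 < p by rewrite (lt_trans ltr01).
by rewrite -(mulr_powRB1 (normr_ge0 c) p0); ring.
Qed.

Lemma burkholder_profile r : burkholder ((r + 1) / 2) ((r - 1) / 2) = profile r / 2.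
Proof.
have p0 : 0 < p by rewrite (lt_trans ltr01).
rewrite /burkholder /profile; case: leP => r1.
  rewrite !ger0_norm; [|lra|lra].
  rewrite /branch -mulrDl addrACA subrr addr0 -mulr2n -[r *+ 2]mulr_natr mulfK//.
  by rewrite -(mulr_powRB1 (le_trans ler01 r1) p0); field.
case: leP => r2.
  rewrite !ler0_norm; [|lra|lra].
  have -> : - ((r + 1) / 2) + - ((r - 1) / 2) = - r by field.
  rewrite /branch.
  have r0 : 0 <= - r by lra.
  by rewrite -(mulr_powRB1 r0 p0); field.
rewrite ger0_norm; last by lra.
rewrite ler0_norm; last by lra.
have -> : (r + 1) / 2 + - ((r - 1) / 2) = 1 by field.
by rewrite powR1; field.
Qed.

Lemma powR_midconvex (x a : R) :
  2 * `|x| `^ p <= `|x + a| `^ p + `|x - a| `^ p.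
Proof.
have h0 : (0 : R) <= 2^-1 by lra.
have h1 : (2^-1 : R) <= 1 by lra.
have := @convex_powR R p (ltW p1) (Itv01 h0 h1) (`|x + a|) (`|x - a|).
rewrite !inE/= !in_itv/= !normr_ge0 => /(_ isT isT); rewrite !convRE /= /unstable.onem.
have -> : 1 - 2^-1 = 2^-1 :> R by lra.
have h : `|x| <= 2^-1 * `|x + a| + 2^-1 * `|x - a|.
  rewrite -mulrDr ler_pdivlMl// (le_trans _ (ler_normD _ _))//.
  have -> : x + a + (x - a) = 2 * x by ring.
  by rewrite normrM ger0_norm.
have : `|x| `^ p <= (2^-1 * `|x + a| + 2^-1 * `|x - a|) `^ p.
  have p0 : 0 <= p by rewrite (le_trans ler01) ?ltW.
  by apply: ge0_ler_powR; rewrite ?nnegrE// (le_trans _ h).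
by rewrite [conv _ _ _]convRE /= /unstable.onem (_ : 1 - 2^-1 = 2^-1 :> R); lra.
Qed.

(** By homogeneity, along the direction [(1, 1)] the function is a rescaled
    [profile] with [t = x - y] as scale; for [t = 0] it is a nonpositive multiple of
    the convex function [|.|^p]. *)
Lemma burkholder_plus x y a :
  burkholder (x + a) (y + a) + burkholder (x - a) (y - a) <= 2 * burkholder x y.
Proof.
pose t := x - y; pose s := x + y.
have [t0|t0] := eqVneq t 0.
  have -> : y = x by apply/esym/eqP; rewrite -subr_eq0; exact/eqP.
  have E u : burkholder u u = (1 - beta) / 2 * (`|2 * u| `^ p).
    have p0 : 0 < p by rewrite (lt_trans ltr01).
    rewrite -(mulr_powRB1 (normr_ge0 (2 * u)) p0) /burkholder.
    have -> : `|2 * u| = `|u| + `|u| by rewrite normrM ger0_norm// mulr2n mulrDl mul1r.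
    by field.
  rewrite !E -mulrDr mulrCA ler_wnM2l//; first by move: b1; lra.
  by rewrite mulrDr mulrBr powR_midconvex.
have E u : burkholder (x + u) (y + u) = `|t| `^ p * profile (s / t + 2 * u / t) / 2.
  rewrite -mulrA -burkholder_profile -burkholderZ; congr burkholder; rewrite /s /t;
   by field.
have -> := E a; have -> := E (- a).
have := E 0; rewrite !addr0 mulr0 mul0r addr0 => ->.
rewrite mulrN mulNr -!mulrDl -mulrDr mulrA ler_wpM2r// mulrCA ler_wpM2l ?powR_ge0//.
by rewrite [X in profile X + _]mulrDl; exact: profile_midconcave.
Qed.

Lemma burkholder_minus x y a :
  burkholder (x + a) (y - a) + burkholder (x - a) (y + a) <= 2 * burkholder x y.
Proof.
have E u v : burkholder u v = burkholder u (- v) by rewrite /burkholder normrN.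
rewrite [X in _ <= 2 * X]E [X in X + _]E [X in _ + X]E.
rewrite opprB opprD (addrC a); exact: burkholder_plus.
Qed.

Lemma burkholder_diag x y : `|x| = `|y| -> burkholder x y <= 0.
Proof.
move=> xy; rewrite /burkholder xy mulr_ge0_le0 ?powR_ge0//.
by rewrite -{1}(mul1r `|y|) -mulrBl mulr_le0_ge0// subr_le0.
Qed.

Definition transform_const : R := beta * (1 + 2 * beta) `^ (p - 1) * 2 + (2 * beta) `^ p.

(** If [|y| >= 2 beta |x|], the linear factor of [burkholder] is at least [|y| / 2];
    otherwise all terms are bounded by multiples of [|x|^p]. *)
Lemma burkholder_major x y :
  `|y| `^ p <= 2 * burkholder x y + transform_const * `|x| `^ p.
Proof.
have p0 : 0 < p by rewrite (lt_trans ltr01).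
have p10 : 0 <= p - 1 by rewrite subr_ge0 ltW.
have b0 : 0 <= beta by apply: le_trans b1.
rewrite /burkholder /transform_const; set X : R := `|x|; set Y : R := `|y|.
have X0 : 0 <= X by exact: normr_ge0.
have Y0 : 0 <= Y by exact: normr_ge0.
have XY0 : 0 <= X + Y by exact: addr_ge0.
(* the threshold at which [Y - beta * X >= Y / 2] *)
have [XY|XY] := leP (2 * beta * X) Y.
  apply: (@le_trans _ _ (2 * ((X + Y) `^ (p - 1) * (Y - beta * X)))); last first.
    by rewrite lerDl mulr_ge0 ?powR_ge0// addr_ge0 ?mulr_ge0 ?powR_ge0.
  rewrite mulrCA -(mulr_powRB1 Y0 p0) mulrC; apply: ler_pM => //.
  - exact: powR_ge0.
  - by apply: ge0_ler_powR; rewrite ?nnegrE// lerDr.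
  - lra.
have h1 : (X + Y) `^ (p - 1) <= (1 + 2 * beta) `^ (p - 1) * X `^ (p - 1).
  have b20 : 0 <= 1 + 2 * beta by lra.
  rewrite -powRM//; apply: ge0_ler_powR; rewrite ?nnegrE//; first exact: mulr_ge0.
  by rewrite mulrDl mul1r lerD2l ltW.
have h2 : Y `^ p <= (2 * beta) `^ p * X `^ p.
  rewrite -powRM ?mulr_ge0//; apply: ge0_ler_powR; rewrite ?nnegrE ?mulr_ge0 ?(ltW p0)//.
  exact: ltW.
have h3 : - (beta * X * ((1 + 2 * beta) `^ (p - 1) * X `^ (p - 1))) <=
    (X + Y) `^ (p - 1) * (Y - beta * X).
  apply: (@le_trans _ _ (- (beta * X * (X + Y) `^ (p - 1)))).
    by rewrite lerN2 ler_wpM2l// mulr_ge0.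
  rewrite mulrC -mulrN ler_wpM2l ?powR_ge0//; lra.
rewrite -(mulr_powRB1 X0 p0) in h2 *.
move: h2 h3; lra.
Qed.

End zigzag.

(** * Haar sums on the dyadic tree *)
Section dyadic_tree.
Variable R : realType.
Implicit Types (a b d : nat -> R) (m j : nat).

(** The value, on the [j]-th dyadic interval of length [2^-m], of the Haar sum with
    coefficients [b] over the indices below [2^m]: this interval is half of the
    interval [j./2] of the previous generation, on which only the Haar function of
    index [2^m + j./2] is new, with sign [+] on the even half. *)
Fixpoint node_value b m j : R :=
  if m is m'.+1 then node_value b m' j./2 + (-1) ^+ odd j * b (2 ^ m' + j./2)%N else b 0%N.

Lemma node_value_double b m j : node_value b m.+1 j.*2 = node_value b m j + b (2 ^ m + j)%N.
Proof. by rewrite /= doubleK odd_double mul1r. Qed.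

Lemma node_value_doubleS b m j : node_value b m.+1 j.*2.+1 = node_value b m j - b (2 ^ m + j)%N.
Proof. by rewrite /= uphalf_double odd_double expr1 mulN1r. Qed.

(** The integral over [[0, 1]] of a function constant on the dyadic intervals of
    length [2^-m]. *)
Definition level_avg m (f : nat -> R) : R := (2 ^+ m)^-1 * \sum_(0 <= j < 2 ^ m) f j.

Lemma sum_double n (f : nat -> R) :
  \sum_(0 <= j < n.*2) f j = \sum_(0 <= j < n) (f j.*2 + f j.*2.+1).
Proof.
elim: n => [|n IH]; first by rewrite !big_geq.
by rewrite doubleS 2?big_nat_recr//= [RHS]big_nat_recr//= IH addrA.
Qed.

Lemma level_avgS m f : level_avg m.+1 f = level_avg m (fun j => (f j.*2 + f j.*2.+1) / 2).
Proof.
by rewrite /level_avg expnS mul2n sum_double exprS invfM -mulr_suml; ring.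
Qed.

Lemma level_avgD m f g : level_avg m (fun j => f j + g j) = level_avg m f + level_avg m g.
Proof. by rewrite /level_avg big_split mulrDr. Qed.

Lemma level_avgZ m c f : level_avg m (fun j => c * f j) = c * level_avg m f.
Proof. by rewrite /level_avg -mulr_sumr mulrCA. Qed.

Lemma ler_level_avg m f g : (forall j, (j < 2 ^ m)%N -> f j <= g j) ->
  level_avg m f <= level_avg m g.
Proof.
move=> fg; rewrite /level_avg ler_wpM2l ?invr_ge0 ?exprn_ge0//.
by rewrite !big_mkord; apply: ler_sum => i _; exact: fg.
Qed.

Lemma eq_level_avg m f g : (forall j, (j < 2 ^ m)%N -> f j = g j) ->
  level_avg m f = level_avg m g.
Proof.
by move=> fg; apply/eqP; rewrite eq_le; apply/andP; split; apply: ler_level_avg => j /fg ->.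
Qed.

Lemma level_avg_ge0 m f : (forall j, 0 <= f j) -> 0 <= level_avg m f.
Proof.
move=> f0; rewrite /level_avg mulr_ge0 ?invr_ge0 ?exprn_ge0//.
by apply: sumr_ge0.
Qed.

Lemma level_avg0 f : level_avg 0 f = f 0%N.
Proof. by rewrite /level_avg expr0 invr1 mul1r expn0 big_nat1. Qed.

Lemma trunc_log_node m j : (j < 2 ^ m)%N -> trunc_log 2 (2 ^ m + j) = m.
Proof. by move=> jm; apply: trunc_log_eq => //; rewrite expnS; lia. Qed.

Lemma sum_levelS m (f : nat -> R) :
  \sum_(0 <= i < 2 ^ m.+1) f i =
  \sum_(0 <= i < 2 ^ m) f i + \sum_(0 <= j < 2 ^ m) f (2 ^ m + j)%N.
Proof.
rewrite expnS mul2n -addnn (@big_cat_nat _ _ _ (2 ^ m)) ?leq_addr//=; congr (_ + _).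
rewrite -{1}[(2 ^ m)%N]add0n big_addn addnK.
by apply: eq_bigr => i _; rewrite addnC.
Qed.

Section transform.
Variables (p beta : R).
Hypothesis p1 : 1 < p.
Hypothesis beta_slope : (beta + 1) * `|p - 2| <= (beta - 1) * p.
Hypothesis b1 : 1 <= beta.
Variables (b s : nat -> R).
Hypothesis hs : forall i, s i = 1 \/ s i = -1.

Let c i := s i * b i.

(** Splitting an interval moves the pair of values by [(b, b)] or [(b, -b)]
    with opposite signs on the two halves, so diagonal concavity makes the average
    decrease with the generation; at the root both values have equal modulus. *)
Lemma burkholder_tree m :
  level_avg m (fun j => burkholder p beta (node_value b m j) (node_value c m j)) <= 0.
Proof.
elim: m => [|m IH].
  rewrite level_avg0 /=; apply: burkholder_diag => //.
  by rewrite /c; case: (hs 0) => ->; rewrite ?mul1r// mulN1r normrN.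
rewrite level_avgS; apply: le_trans IH; apply: ler_level_avg => j _.
rewrite !node_value_double !node_value_doubleS ler_pdivrMr// [leRHS]mulrC.
rewrite /c; case: (hs (2 ^ m + j)%N) => ->.
  by rewrite mul1r; exact: burkholder_plus.
by rewrite mulN1r opprK; exact: burkholder_minus.
Qed.

Lemma sign_transform_le m :
  level_avg m (fun j => `|node_value c m j| `^ p) <=
  transform_const p beta * level_avg m (fun j => `|node_value b m j| `^ p).
Proof.
rewrite -level_avgZ -[leRHS]add0r.
apply: (@le_trans _ _ (level_avg m (fun j =>
    2 * burkholder p beta (node_value b m j) (node_value c m j) +
    transform_const p beta * `|node_value b m j| `^ p))).
  by apply: ler_level_avg => j _; exact: burkholder_major.
rewrite level_avgD lerD2r level_avgZ pmulr_rle0//; exact: burkholder_tree.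
Qed.

End transform.

(** The inverse of the length of the support of the Haar function of index [i]. *)
Definition inv_len (i : nat) : R := (2 ^ trunc_log 2 i)%N%:R.

Lemma inv_len_gt0 i : 0 < inv_len i. Proof. by rewrite ltr0n expn_gt0. Qed.

Lemma inv_len_node m j : (j < 2 ^ m)%N -> inv_len (2 ^ m + j) = 2 ^+ m.
Proof. by move=> jm; rewrite /inv_len trunc_log_node// natrX. Qed.

Lemma inv_len0 : inv_len 0 = 1. Proof. by rewrite /inv_len trunc_log0. Qed.

(** The same recursion as [node_value] without signs: the sum of the weights of the
    Haar functions that live on a given dyadic interval. *)
Fixpoint ancestor_sum a m j : R :=
  if m is m'.+1 then ancestor_sum a m' j./2 + a (2 ^ m' + j./2)%N else a 0%N.

Lemma ancestor_sum_ge0 a m j : (forall i, 0 <= a i) -> 0 <= ancestor_sum a m j.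
Proof. by move=> a0; elim: m j => [|m IH] j //=; rewrite addr_ge0. Qed.

(** The indicator of the support of the [i]-th Haar function, multiplied by
    [inv_len i], has average [1]. *)
Lemma level_avg_ancestor_sum a m :
  level_avg m (ancestor_sum (fun i => inv_len i * a i) m) = \sum_(0 <= i < 2 ^ m) a i.
Proof.
elim: m => [|m IH]; first by rewrite level_avg0 /= expn0 big_nat1 inv_len0 mul1r.
rewrite level_avgS sum_levelS -IH.
rewrite (@eq_level_avg m _ (fun j =>
    ancestor_sum (fun i => inv_len i * a i) m j + inv_len (2 ^ m + j) * a (2 ^ m + j)%N)).
  rewrite level_avgD; congr (_ + _).
  rewrite (@eq_level_avg m _ (fun j => 2 ^+ m * a (2 ^ m + j)%N)).
    by rewrite level_avgZ /level_avg mulVKf// expf_neq0.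
  by move=> j jm; rewrite inv_len_node.
by move=> j jm /=; rewrite uphalf_double doubleK; field.
Qed.

Section upper.
Variable p : R.
Hypothesis p1 : 1 <= p.

(** The fixed point of [c |-> (c + 1) / 2^(1/p)], that is, the constant for which a
    bound [c * W] by the current scale [W] survives adding [W] and passing to the
    next scale [2^(1/p) * W]. *)
Definition geo_const : R := (2 `^ p^-1 - 1)^-1.
Definition upper_const : R := (geo_const + 1) `^ p.

Let p0 : 0 < p. Proof. exact: lt_le_trans p1. Qed.

Lemma root2_gt1 : 1 < 2 `^ p^-1.
Proof.
have -> : 1 < 2 `^ p^-1 = (1 `^ p^-1 < 2 `^ p^-1) by rewrite powR1.
by rewrite gt0_ltr_powR ?invr_gt0 ?nnegrE// ltr1n.
Qed.

Lemma root2_le2 : 2 `^ p^-1 <= 2.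
Proof. by apply: ler1_powR; rewrite ?ler1n// invf_le1. Qed.

Lemma geo_const_ge1 : 1 <= geo_const.
Proof.
have h1 := root2_gt1; have h2 := root2_le2.
by rewrite /geo_const -[leLHS]invr1 lef_pV2 ?posrE; lra.
Qed.

Lemma geo_constE : geo_const + 1 = geo_const * 2 `^ p^-1.
Proof.
have h1 := root2_gt1; rewrite /geo_const.
have h : 2 `^ p^-1 - 1 != 0 by lra.
by field.
Qed.

(** The factor that normalizes the Haar function of index [i] in [L_p]. *)
Definition haar_scale i : R := inv_len i `^ p^-1.

Lemma haar_scale_gt0 i : 0 < haar_scale i. Proof. by rewrite powR_gt0// inv_len_gt0. Qed.

(** The scales grow geometrically along a branch, so the sum of those selected by
    [A] is at most a constant times the last one; its [p]-th power is then at most a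
    constant times a single term of [ancestor_sum]. *)
Lemma node_value_upper (A : pred nat) b m j :
  (forall i, `|b i| <= haar_scale i * (A i)%:R) -> (j < 2 ^ m)%N ->
  `|node_value b m j| <= geo_const * (2 ^+ m) `^ p^-1 /\
  `|node_value b m j| `^ p <= upper_const * ancestor_sum (fun i => inv_len i * (A i)%:R) m j.
Proof.
move=> hbA; elim: m j => [|m IH] j jm.
  have := hbA 0%N; rewrite /= /haar_scale inv_len0 !mul1r powR1 mul1r ?expr0 ?powR1 ?mulr1 => h.
  split.
    by apply: le_trans h _; apply: le_trans geo_const_ge1; rewrite lern1 leq_b1.
  apply: (@le_trans _ _ ((A 0%N)%:R `^ p)).
    by apply: ge0_ler_powR; rewrite ?nnegrE// ltW.
  case: (A 0%N); last by rewrite mulr0 powR0// gt_eqF.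
  have g1 := geo_const_ge1.
  have -> : 1%:R `^ p <= upper_const * 1 = (1 `^ p <= (geo_const + 1) `^ p) by rewrite mulr1.
  by apply: ge0_ler_powR; rewrite ?nnegrE ?ltW//; lra.
have jm2 : (j./2 < 2 ^ m)%N by move: jm; rewrite expnS; lia.
have [h1 h2] := IH _ jm2.
have := hbA (2 ^ m + j./2)%N; rewrite {1}/haar_scale !inv_len_node//= => h.
set B := b _ in h *; set T := node_value b m j./2 in h1 h2 *.
have hT : `|T + (-1) ^+ odd j * B| <= `|T| + `|B|.
  by apply: le_trans (ler_normD _ _) _; rewrite normrM normrX normrN1 expr1n mul1r.
set W := (2 ^+ m) `^ p^-1 in h h1.
have W0 : 0 <= W by exact: powR_ge0.
have WS : (2 ^+ m.+1) `^ p^-1 = 2 `^ p^-1 * W by rewrite exprS powRM// exprn_ge0.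
have g1 := geo_const_ge1.
have hS : `|T| + `|B| <= (geo_const + 1) * W.
  rewrite mulrDl mul1r lerD// (le_trans h)//.
  by rewrite -[leRHS]mulr1 ler_wpM2l// lern1 leq_b1.
split; first by rewrite (le_trans hT)// WS mulrA -geo_constE.
case hA : (A _) h => h; last first.
  have B0 : B = 0 by apply/eqP; rewrite -normr_le0 (le_trans h)// mulr0.
  by rewrite B0 !mulr0 !addr0.
apply: (@le_trans _ _ (((geo_const + 1) * W) `^ p)).
  have gW : 0 <= (geo_const + 1) * W by rewrite mulr_ge0//; lra.
  by apply: ge0_ler_powR; rewrite ?nnegrE ?(ltW p0)// (le_trans hT).
have WE : W `^ p = 2 ^+ m.
  by rewrite /W -powRrM mulVf ?gt_eqF// powRr1// exprn_ge0.
have g0 : 0 <= geo_const + 1 by lra.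
rewrite (powRM _ g0 W0) WE mulr1 -/upper_const ler_wpM2l ?powR_ge0//.
by rewrite /= inv_len_node// lerDr ancestor_sum_ge0// => i; rewrite mulr_ge0// ltW// inv_len_gt0.
Qed.

Lemma level_avg_upper (A : pred nat) b m :
  (forall i, `|b i| <= haar_scale i * (A i)%:R) ->
  level_avg m (fun j => `|node_value b m j| `^ p) <=
  upper_const * \sum_(0 <= i < 2 ^ m) (A i)%:R.
Proof.
move=> hbA; rewrite -level_avg_ancestor_sum -level_avgZ; apply: ler_level_avg => j jm.
by have [] := node_value_upper hbA jm.
Qed.

Lemma upper_const_ge0 : 0 <= upper_const. Proof. exact: powR_ge0. Qed.

End upper.

(** Orthogonality of the Haar functions. *)
Lemma level_avg_dual b d m :
  level_avg m (fun j => node_value b m j * node_value d m j) =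
  \sum_(0 <= i < 2 ^ m) b i * d i / inv_len i.
Proof.
elim: m => [|m IH]; first by rewrite level_avg0 /= expn0 big_nat1 inv_len0 divr1.
rewrite level_avgS sum_levelS -IH.
rewrite (@eq_level_avg m _ (fun j =>
    node_value b m j * node_value d m j + b (2 ^ m + j)%N * d (2 ^ m + j)%N)).
  rewrite level_avgD; congr (_ + _).
  rewrite /level_avg mulr_sumr; apply: eq_big_nat => j jm.
  by rewrite inv_len_node// mulrC.
by move=> j jm; rewrite !node_value_double !node_value_doubleS; field.
Qed.

Lemma hoelder_sum (p q : R) (u v : nat -> R) n : 0 < p -> 0 < q ->
  p^-1 + q^-1 = 1 -> (forall i, 0 <= u i) -> (forall i, 0 <= v i) ->
  \sum_(0 <= j < n) u j * v j <=
  (\sum_(0 <= j < n) u j `^ p) `^ p^-1 * (\sum_(0 <= j < n) v j `^ q) `^ q^-1.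
Proof.
move=> p0 q0 pq u0 v0; elim: n => [|n IH].
  by rewrite !big_geq// mulr_ge0// powR_ge0.
rewrite !big_nat_recr //=; set U := \sum_(0 <= i < n) u i `^ p in IH *.
set V := \sum_(0 <= i < n) v i `^ q in IH *.
have U0 : 0 <= U by apply: sumr_ge0 => i _; exact: powR_ge0.
have V0 : 0 <= V by apply: sumr_ge0 => i _; exact: powR_ge0.
have := @hoelder2 R (U `^ p^-1) (u n) (V `^ q^-1) (v n) p q (powR_ge0 _ _)
  (u0 n) (powR_ge0 _ _) (v0 n) p0 q0 pq.
rewrite -!powRrM !mulVf ?gt_eqF// !powRr1//; apply: le_trans.
by rewrite lerD2r.
Qed.

Lemma hoelder_level_avg (p q : R) (u v : nat -> R) m : 0 < p -> 0 < q ->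
  p^-1 + q^-1 = 1 ->
  level_avg m (fun j => u j * v j) <=
  (level_avg m (fun j => `|u j| `^ p)) `^ p^-1 * (level_avg m (fun j => `|v j| `^ q)) `^ q^-1.
Proof.
move=> p0 q0 pq.
apply: (@le_trans _ _ (level_avg m (fun j => `|u j| * `|v j|))).
  by apply: ler_level_avg => j _; rewrite -normrM ler_norm.
have c0 : 0 <= (2 ^+ m)^-1 :> R by rewrite invr_ge0 exprn_ge0.
have s0 (f : nat -> R) r : 0 <= \sum_(0 <= j < 2 ^ m) `|f j| `^ r.
  by apply: sumr_ge0 => i _; exact: powR_ge0.
rewrite /level_avg !powRM// mulrACA -powRD ?pq ?oner_eq0// powRr1//.
by rewrite ler_wpM2l// hoelder_sum.
Qed.

(** The sum is a pairing with the [L_q]-normalized Haar sum over [A] whose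
    coefficients are the signs of [b]; its norm is controlled by the upper estimate
    with exponent [q]. *)
Lemma level_avg_lower (p q : R) (A : pred nat) b m : 1 < p -> 1 < q -> p^-1 + q^-1 = 1 ->
  \sum_(0 <= i < 2 ^ m) `|b i| * (A i)%:R <=
  (level_avg m (fun j => `|node_value (fun i => haar_scale p i * b i) m j| `^ p)) `^ p^-1 *
  (upper_const q * \sum_(0 <= i < 2 ^ m) (A i)%:R) `^ q^-1.
Proof.
move=> p1 q1 pq.
have p0 : 0 < p by rewrite (lt_trans ltr01).
have q0 : 0 < q by rewrite (lt_trans ltr01).
(* the product of the two normalizing factors is [inv_len], which [level_avg_dual]
   divides out *)
pose d i := haar_scale q i * (Num.sg (b i) * (A i)%:R).
have -> : \sum_(0 <= i < 2 ^ m) `|b i| * (A i)%:R =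
    level_avg m (fun j => node_value (fun i => haar_scale p i * b i) m j * node_value d m j).
  rewrite level_avg_dual; apply: eq_bigr => i _; rewrite /d.
  have E : haar_scale p i * haar_scale q i = inv_len i.
    rewrite /haar_scale -powRD ?pq ?oner_eq0// powRr1// ltW// inv_len_gt0//.
  have l0 : inv_len i != 0 by rewrite gt_eqF// inv_len_gt0.
  apply: (mulIf l0); rewrite divfK// -{1}E normrEsg; ring.
apply: le_trans (hoelder_level_avg _ _ _ p0 q0 pq) _.
rewrite ler_wpM2l ?powR_ge0//; apply: ge0_ler_powR.
- by rewrite invr_ge0 ltW.
- by rewrite nnegrE level_avg_ge0// => j; exact: powR_ge0.
- by rewrite nnegrE mulr_ge0 ?upper_const_ge0// sumr_ge0.
apply: level_avg_upper; first exact: ltW.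
move=> i; rewrite /d !normrM gtr0_norm ?haar_scale_gt0// ler_wpM2l ?(ltW (haar_scale_gt0 _ _))//.
by rewrite normr_nat ler_piMl// normr_sg lern1 leq_b1.
Qed.

Lemma level_avg_delta (p : R) i m : 0 < p -> (i < 2 ^ m)%N ->
  level_avg m (fun j => `|node_value (fun k => (k == i)%:R) m j| `^ p) = (inv_len i)^-1.
Proof.
move=> p0; elim: m => [|m IH].
  by rewrite expn0 ltnS leqn0 => /eqP ->; rewrite level_avg0 /= normr1 powR1 inv_len0 invr1.
have tv0 k j : (j < 2 ^ k)%N -> (2 ^ k <= i)%N -> node_value (fun k => (k == i)%:R) k j = 0.
  elim: k j => [|k IHk] j jk ki; first by rewrite /= (_ : 0%N == i = false)//; move: ki; lia.
  rewrite /= IHk; [|by move: jk; rewrite expnS; lia|by move: ki; rewrite expnS; lia].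
  rewrite (_ : _ == i = false) ?mulr0 ?addr0//.
  by apply/negbTE/eqP => E; move: jk ki; rewrite expnS; lia.
move=> im; rewrite level_avgS; have [ilt|ige] := ltnP i (2 ^ m).
  rewrite -IH//; apply: eq_level_avg => j jm; rewrite !node_value_double !node_value_doubleS.
  rewrite (_ : (_ == i) = false); last by apply/eqP; lia.
  by rewrite addr0 subr0; field.
rewrite (@eq_level_avg m _ (fun j => (2 ^ m + j == i)%N%:R)).
  pose k := (i - 2 ^ m)%N; have Ei : i = (2 ^ m + k)%N by rewrite subnKC.
  have km : (k < 2 ^ m)%N by move: im; rewrite expnS; lia.
  rewrite {2}Ei inv_len_node// /level_avg big_mkord (bigD1 (Ordinal km))//= Ei eqxx.
  rewrite big1 ?addr0 ?mulr1//.
  by move=> [x xm] /eqP E /=; rewrite eqn_add2l; case: eqP => // E'; case: E; exact/val_inj.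
move=> j jm; rewrite !node_value_double !node_value_doubleS tv0// add0r sub0r normrN.
case: eqP => _ /=; first by rewrite normr1 powR1; field.
by rewrite normr0 powR0 ?gt_eqF// addr0 mul0r.
Qed.

End dyadic_tree.

(** * Linear combinations and closed spans *)
Lemma is_sumP (R : realType) (X : lmodType R) (N : X -> R) (e : nat -> X) a x :
  (forall y, 0 <= N y) ->
  is_sum N e a x <-> forall eta : R, 0 < eta ->
    exists n0, forall n, (n0 <= n)%N -> N (x - \sum_(i < n) a i *: e i) < eta.
Proof.
move=> N0; split=> [/cvgrPdist_lt h eta /h [n0 _ hn]|h].
  exists n0 => n n0n; have := hn n n0n.
  by rewrite /= sub0r normrN ger0_norm.
apply/cvgrPdist_lt => eta /h [n0 hn]; exists n0 => // n n0n /=.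
by rewrite sub0r normrN ger0_norm// hn.
Qed.

Lemma sum_fset_ltn (V : nmodType) (A : {fset nat}) (F : nat -> V) n :
  \sum_(i < n | val i \in A) F i = \sum_(i <- A | (i < n)%N) F i.
Proof.
rewrite -(big_mkord (fun i => i \in A) F) -big_filter -[RHS]big_filter.
apply: perm_big; apply: uniq_perm; rewrite ?filter_uniq ?iota_uniq ?fset_uniq//.
by move=> i; rewrite !mem_filter mem_index_iota /= andbC.
Qed.

Lemma fset_bounded (A : {fset nat}) : exists n, forall i, i \in A -> (i < n)%N.
Proof.
exists (\max_(i <- A) i).+1 => i iA; rewrite ltnS.
by rewrite (big_rem i)//= leq_maxl.
Qed.

Lemma sum_fset_all (V : nmodType) (A : {fset nat}) (F : nat -> V) n :
  (forall i, i \in A -> (i < n)%N) ->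
  \sum_(i <- A | (i < n)%N) F i = \sum_(i <- A) F i.
Proof.
move=> An; rewrite big_seq_cond [RHS]big_seq; apply: eq_bigl => j.
by case jA: (j \in A) => //=; rewrite An.
Qed.

Lemma sum_fsetI (V : nmodType) (F A : {fset nat}) (f : nat -> V) :
  \sum_(i <- F | i \in A) f i = \sum_(i <- (F `&` A)%fset) f i.
Proof.
rewrite -big_filter; apply: perm_big; apply: uniq_perm; rewrite ?filter_uniq ?fset_uniq//.
by move=> i; rewrite mem_filter inE andbC.
Qed.

Lemma sum_fsetU_disjoint (V : nmodType) (A B : {fset nat}) (f : nat -> V) :
  [disjoint A & B]%fset ->
  \sum_(i <- (A `|` B)%fset) f i = \sum_(i <- A) f i + \sum_(i <- B) f i.
Proof.
move=> /fdisjointP AB; rewrite -big_cat; apply: perm_big; apply: uniq_perm.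
- exact: fset_uniq.
- rewrite cat_uniq !fset_uniq andbT /=; apply/hasPn => i iB.
  by apply/negP => /AB; rewrite iB.
- by move=> i; rewrite mem_cat inE.
Qed.

Lemma ler_sum_card (R : numDomainType) (A : {fset nat}) (f : nat -> R) t :
  (forall i, i \in A -> f i <= t) -> \sum_(i <- A) f i <= t * #|` A|%:R.
Proof.
move=> ft; rewrite mulr_natr -iter_addr_0 -(count_predT A) -big_const_seq big_seq [leRHS]big_seq.
exact: ler_sum.
Qed.

Lemma ger_sum_card (R : numDomainType) (A : {fset nat}) (f : nat -> R) t :
  (forall i, i \in A -> t <= f i) -> t * #|` A|%:R <= \sum_(i <- A) f i.
Proof.
move=> ft; rewrite mulr_natr -iter_addr_0 -(count_predT A) -big_const_seq big_seq [leRHS]big_seq.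
exact: ler_sum.
Qed.

Lemma subfset_card (A : {fset nat}) k : (k <= #|` A|)%N ->
  exists2 B : {fset nat}, (B `<=` A)%fset & #|` B| = k.
Proof.
move=> kA; exists [fset x in take k A]%fset.
  by apply/fsubsetP => i; rewrite !inE => /mem_take.
rewrite card_fseq undup_id ?take_uniq ?fset_uniq// size_takel//.
Qed.

Section lincomb.
Variables (R : realType) (X : lmodType R) (e : nat -> X).

Definition lincomb (b : nat -> R) n : X := \sum_(i < n) b i *: e i.
Local Notation S := lincomb.

Lemma lincomb0 b : S b 0 = 0.
Proof. by rewrite /lincomb big_ord0. Qed.

Lemma lincombD a b n : S (fun i => a i + b i) n = S a n + S b n.
Proof. by rewrite /lincomb -big_split; apply: eq_bigr => i _; rewrite scalerDl. Qed.

Lemma lincombB a b n : S (fun i => a i - b i) n = S a n - S b n.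
Proof. by rewrite /lincomb -sumrB; apply: eq_bigr => i _; rewrite scalerBl. Qed.

Lemma lincombZ c b n : S (fun i => c * b i) n = c *: S b n.
Proof. by rewrite /lincomb scaler_sumr; apply: eq_bigr => i _; rewrite scalerA. Qed.

Lemma eq_lincomb a b n : (forall i, (i < n)%N -> a i = b i) -> S a n = S b n.
Proof. by move=> ab; apply: eq_bigr => i _; rewrite ab. Qed.

Lemma lincomb_trunc a n m : (n <= m)%N -> (forall i, (n <= i)%N -> a i = 0) -> S a m = S a n.
Proof.
move=> nm a0; rewrite /lincomb -!(big_mkord xpredT (fun i => a i *: e i)).
rewrite (@big_cat_nat _ _ _ n)//= [X in _ + X]big_nat_cond [X in _ + X]big1 ?addr0// => i.
by rewrite andbT => /andP[ni _]; rewrite a0// scale0r.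
Qed.

Lemma lincomb_fset (A : {fset nat}) b n :
  S (fun i => b i * (i \in A)%:R) n = \sum_(i <- A | (i < n)%N) b i *: e i.
Proof.
rewrite -sum_fset_ltn [RHS]big_mkcond; apply: eq_bigr => i _.
by case: ifP => _; rewrite ?mulr1// mulr0 scale0r.
Qed.

End lincomb.

Section span_closure.
Variables (R : realType) (X : normedModType R) (e : nat -> X).
Local Notation S := (lincomb e).

Definition span_closure : set X := [set x |
  forall eta : R, 0 < eta -> exists n (a : nat -> R), `|x - lincomb e a n| < eta].

Lemma span_closureD x y : span_closure x -> span_closure y -> span_closure (x + y).
Proof.
move=> hx hy eta eta0; have e2 : 0 < eta / 2 by lra.
have [n [a ha]] := hx _ e2; have [m [b hb]] := hy _ e2.
pose a' i := if (i < n)%N then a i else 0; pose b' i := if (i < m)%N then b i else 0.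
exists (n + m)%N, (fun i => a' i + b' i).
have E1 : S a' (n + m) = S a n.
  rewrite (@lincomb_trunc _ _ _ _ n) ?leq_addr//.
    by apply: eq_lincomb => i ii; rewrite /a' ii.
  by move=> i; rewrite leqNgt /a' => /negbTE ->.
have E2 : S b' (n + m) = S b m.
  rewrite (@lincomb_trunc _ _ _ _ m) ?leq_addl//.
    by apply: eq_lincomb => i ii; rewrite /b' ii.
  by move=> i; rewrite leqNgt /b' => /negbTE ->.
rewrite lincombD E1 E2 opprD addrACA (le_lt_trans (ler_normD _ _))//.
by rewrite [eta]splitr ltrD.
Qed.

Lemma span_closureZ c x : span_closure x -> span_closure (c *: x).
Proof.
move=> hx eta eta0; have c1 : 0 < `|c| + 1 by rewrite ltr_wpDl.
have [n [a ha]] := hx _ (divr_gt0 eta0 c1).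
exists n, (fun i => c * a i).
rewrite lincombZ -scalerBr normrZ (le_lt_trans (ler_wpM2l (normr_ge0 c) (ltW ha)))//.
by rewrite mulrCA -[ltRHS]mulr1 ltr_pM2l// ltr_pdivrMr// mul1r ltrDl.
Qed.

Lemma span_closure_lim x :
  (forall eta : R, 0 < eta -> exists2 y, span_closure y & `|x - y| < eta) -> span_closure x.
Proof.
move=> h eta eta0; have e2 : 0 < eta / 2 by lra.
have [y hy xy] := h _ e2; have [n [a ha]] := hy _ e2.
exists n, a; rewrite -(subrKA y) (le_lt_trans (ler_normD _ _))//.
by rewrite [eta]splitr ltrD.
Qed.

Lemma span_closure_gen i : span_closure (e i).
Proof.
move=> eta eta0; exists i.+1, (fun j => (j == i)%:R).
rewrite /lincomb big_ord_recr/= eqxx scale1r big1 ?add0r ?subrr ?normr0// => j _.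
by rewrite ltn_eqF// scale0r.
Qed.

Lemma span_closureB x y : span_closure x -> span_closure y -> span_closure (x - y).
Proof.
by move=> hx hy; apply: span_closureD => //; rewrite -scaleN1r; exact: span_closureZ.
Qed.

End span_closure.

Section multipliers.
Variables (R : realType) (X : normedModType R) (e : nat -> X) (K : R).
Local Notation S := (lincomb e).
Hypothesis hs : forall n (s b : nat -> R), (forall i, s i = 1 \/ s i = -1) ->
  `|S (fun i => s i * b i) n| <= K * `|S b n|.

(** The norm of a linear combination is convex in each multiplier, so multipliers in
    [[-1, 1]] can be replaced by signs, one index at a time. *)
Lemma multiplier_of_signs n (a b : nat -> R) :
  (forall i, `|a i| <= `|b i|) -> `|S a n| <= K * `|S b n|.
Proof.
move=> ab.
have step k l : (forall i, `|l i| <= 1) -> (forall i, (k <= i)%N -> l i = 1 \/ l i = -1) ->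
    `|S (fun i => l i * b i) n| <= K * `|S b n|.
  elim: k l => [|k IH] l l1 lk; first by apply: hs => i; exact: lk.
  (* [l k] is a convex combination of [1] and [-1] *)
  pose lp i := if i == k then 1 else l i; pose lm i := if i == k then -1 else l i.
  have hp : `|S (fun i => lp i * b i) n| <= K * `|S b n|.
    apply: IH => [i|i ki]; rewrite /lp; case: eqP => ik.
    - by rewrite normr1.
    - exact: l1.
    - by left.
    - by apply: lk; lia.
  have hm : `|S (fun i => lm i * b i) n| <= K * `|S b n|.
    apply: IH => [i|i ki]; rewrite /lm; case: eqP => ik.
    - by rewrite normrN1.
    - exact: l1.
    - by right.
    - by apply: lk; lia.
  have -> : S (fun i => l i * b i) n = ((1 + l k) / 2) *: S (fun i => lp i * b i) n +
      ((1 - l k) / 2) *: S (fun i => lm i * b i) n.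
    rewrite -!lincombZ -lincombD; apply: eq_lincomb => i _.
    by rewrite /lp /lm; case: eqP => [->|_]; field.
  have /andP[lk1 lk2] : -1 <= l k <= 1 by rewrite -ler_norml.
  have c1 : 0 <= (1 + l k) / 2 by lra.
  have c2 : 0 <= (1 - l k) / 2 by lra.
  apply: le_trans (ler_normD _ _) _; rewrite [X in X + _]normrZ [X in _ + X]normrZ.
  rewrite (ger0_norm c1) (ger0_norm c2).
  set A := K * _ in hp hm *.
  have -> : A = (1 + l k) / 2 * A + (1 - l k) / 2 * A by field.
  by apply: lerD; rewrite ler_wpM2l.
pose l i := if (i < n)%N then (if b i == 0 then 0 else a i / b i) else 1.
have -> : S a n = S (fun i => l i * b i) n.
  apply: eq_lincomb => i i_n; rewrite /l i_n; case: eqP => [b0|/eqP b0]; last by rewrite divfK.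
  by have := ab i; rewrite b0 normr0 normr_le0 => /eqP ->; rewrite mulr0.
apply: (step n) => i; last by rewrite /l leqNgt => /negbTE ->; left.
rewrite /l; case: ifP => _; last by rewrite normr1.
case: eqP => [_|/eqP b0]; first by rewrite normr0.
by rewrite normrM normfV ler_pdivrMr ?normr_gt0// mul1r.
Qed.

End multipliers.

(** * Renorming a basis with power fundamental functions *)
Section renorm.
Variables (R : realType) (X : normedModType R) (e : nat -> X) (p q K C : R).
Hypotheses (p0 : 0 < p) (q0 : 0 < q) (pq : p^-1 + q^-1 = 1).
Hypotheses (K0 : 0 <= K) (C0 : 0 <= C).

Local Notation S := (lincomb e).

Hypothesis uncond : forall n a b, (forall i, `|a i| <= `|b i|) -> `|S a n| <= K * `|S b n|.
Hypothesis dense : forall x (eta : R), 0 < eta -> exists n a, `|x - S a n| < eta.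
Hypothesis upper : forall (A : {fset nat}) (b : nat -> R), (forall i, `|b i| <= 1) ->
  `|\sum_(i <- A) b i *: e i| <= C * (#|` A|%:R) `^ p^-1.
Hypothesis lower : forall n (A : {fset nat}) (b : nat -> R),
  \sum_(i <- A | (i < n)%N) `|b i| <= C * (#|` A|%:R) `^ q^-1 * `|S b n|.

Lemma is_sumS a x : is_sum Num.norm e a x <-> forall eta : R, 0 < eta ->
  exists n0, forall n, (n0 <= n)%N -> `|x - S a n| < eta.
Proof. exact/is_sumP/normr_ge0. Qed.

Lemma coef_le i n b : (i < n)%N -> `|b i| <= C * `|S b n|.
Proof.
move=> i_n; have := lower n [fset i]%fset b.
by rewrite cardfs1 powR1 mulr1 big_mkcond big_seq_fset1 i_n.
Qed.

Lemma sum_unique a b x : is_sum Num.norm e a x -> is_sum Num.norm e b x -> a = b.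
Proof.
move=> /(is_sumP _ _ _ (@normr_ge0 _ X)) ha /(is_sumP _ _ _ (@normr_ge0 _ X)) hb.
apply/funext => i; apply/eqP; rewrite -subr_eq0 -normr_le0; apply/ler_addgt0Pr => eta eta0.
have eC0 : 0 < eta / (2 * (C + 1)) by rewrite divr_gt0// mulr_gt0// ltr_wpDl.
have [n1 h1] := ha _ eC0; have [n2 h2] := hb _ eC0.
pose n := (n1 + n2 + i.+1)%N.
have := @coef_le i n (fun i => a i - b i) (leq_addl _ _).
rewrite lincombB add0r => /le_trans; apply.
have {}h1 := h1 n _; have {}h2 := h2 n _.
have -> : S a n - S b n = (x - S b n) - (x - S a n) by rewrite opprB [RHS]addrC subrKA.
have h : `|x - S b n - (x - S a n)| <= eta / (C + 1).
  rewrite (le_trans (ler_normB _ _))//.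
  have -> : eta / (C + 1) = eta / (2 * (C + 1)) + eta / (2 * (C + 1)).
    by field; rewrite gt_eqF// ltr_wpDl.
  by rewrite lerD// ltW// ?h1 ?h2// /n; lia.
apply: le_trans (ler_wpM2l C0 h) _.
rewrite mulrCA ler_piMr ?(ltW eta0)// ler_pdivrMr ?ltr_wpDl// mul1r lerDl//.
Qed.

(** The coefficients of approximating linear combinations form Cauchy sequences by
    [coef_le], and unconditionality controls the partial sums of the limiting
    coefficients uniformly in their length. *)
Lemma sum_exists x : exists a, is_sum Num.norm e a x.
Proof.
have hk k : exists na : nat * (nat -> R), `|x - S na.2 na.1| < k.+1%:R^-1.
  have /(dense x) [n [a h]] : 0 < k.+1%:R^-1 :> R by rewrite invr_gt0.
  by exists (n, a).
have [na {}hk] := choice hk.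
(* approximants extended by zero, so that all partial sums are eventually equal *)
pose b k i : R := if (i < (na k).1)%N then (na k).2 i else 0.
have hb k n : ((na k).1 <= n)%N -> `|x - S (b k) n| < k.+1%:R^-1.
  move=> kn; rewrite (_ : S (b k) n = S (na k).2 (na k).1)//.
  rewrite (lincomb_trunc _ kn); first by apply: eq_lincomb => i ik; rewrite /b ik.
  by move=> i; rewrite leqNgt /b => /negbTE ->.
have hbb k l n : `|S (b k) n - S (b l) n| <= K * (k.+1%:R^-1 + l.+1%:R^-1).
  pose m := (n + (na k).1 + (na l).1)%N.
  pose d i := b k i - b l i; rewrite -lincombB.
  have -> : S d n = S (fun i => if (i < n)%N then d i else 0) m.
    rewrite (@lincomb_trunc _ _ _ _ n); first by apply: eq_lincomb => i ->.
      by rewrite /m; lia.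
    by move=> i; rewrite leqNgt => /negbTE ->.
  have : `|S (fun i => if (i < n)%N then d i else 0) m| <= K * `|S d m|.
    by apply: uncond => i; case: ifP => // _; rewrite normr0.
  move=> /le_trans; apply; rewrite ler_wpM2l// lincombB.
  have -> : S (b k) m - S (b l) m = (x - S (b l) m) - (x - S (b k) m).
    by rewrite opprB [RHS]addrC subrKA.
  rewrite (le_trans (ler_normB _ _))// addrC lerD// ltW// hb// /m; lia.
have hcoef k l i : `|b k i - b l i| <= C * (k.+1%:R^-1 + l.+1%:R^-1).
  pose m := (i.+1 + (na k).1 + (na l).1)%N.
  have im : (i < m)%N by rewrite /m; lia.
  apply: le_trans (@coef_le i m (fun i => b k i - b l i) im) _.
  rewrite ler_wpM2l// lincombB.
  have -> : S (b k) m - S (b l) m = (x - S (b l) m) - (x - S (b k) m).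
    by rewrite opprB [RHS]addrC subrKA.
  rewrite (le_trans (ler_normB _ _))// addrC lerD// ltW// hb// /m; lia.
have small (c eta : R) : 0 <= c -> 0 < eta ->
    exists k0, forall k, (k0 <= k)%N -> c * k.+1%:R^-1 < eta.
  move=> c0 eta0; exists (Num.truncn (c / eta)) => k kk.
  rewrite ltr_pdivrMr// -ltr_pdivrMl// mulrC.
  by rewrite (lt_le_trans (truncnS_gt _))// ler_nat.
have hcauchy i (eta : R) : 0 < eta ->
    exists k0, forall k l, (k0 <= k)%N -> (k0 <= l)%N -> `|b k i - b l i| < eta.
  move=> eta0.
  have [k0 hk0] := small (2 * C) eta (mulr_ge0 (ler0n _ 2) C0) eta0.
  exists k0 => k l kk ll; apply: le_lt_trans (hcoef _ _ _) _.
  have := hk0 _ kk; have := hk0 _ ll.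
  by move: (k.+1%:R^-1 : R) (l.+1%:R^-1 : R) => u v; lra.
have hlim i : cvgn (fun k => b k i).
  apply: cauchy_cvg; apply/cauchy_ballP => eta eta0.
  have [k0 hk0] := hcauchy i eta eta0.
  exists ([set r | exists2 k, (k0 <= k)%N & r = b k i],
     [set r | exists2 k, (k0 <= k)%N & r = b k i]).
  - by split; exists k0 => // k kk; exists k.
  - by move=> [u v] /= [[k kk ->] [l ll ->]]; exact: hk0.
exists (fun i => limn (fun k => b k i)).
apply/(is_sumP _ _ _ (@normr_ge0 _ X)) => eta eta0.
(* The error will be at most [1 + 2 * K] times [1 / (k1 + 1)], plus [eta / 2]. *)
have [||k1 h1] := small (3 + 2 * K) (eta / 2); [by move: K0; lra|lra|].
have {h1} h1 := h1 k1 (leqnn _).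
exists (na k1).1 => n kn.
have Slim : S (b k) n @[k --> \oo] --> S (fun i => limn (fun k => b k i)) n.
  apply: (cvg_big (op := +%R) (@add_continuous X)) => i _ /=; apply: cvgZr_tmp; exact: hlim.
have e2 : 0 < eta / 2 by lra.
have /cvgrPdist_lt/(_ _ e2) [l0 _ hl0] := Slim.
pose l := (l0 + k1)%N.
have := hl0 l (leq_addr _ _); rewrite /= distrC => hl.
have hx := hb _ _ kn; have hxl := hbb k1 l n.
have hlk : (l.+1%:R)^-1 <= k1.+1%:R^-1 :> R.
  by rewrite lef_pV2 ?posrE// ler_nat ltnS leq_addl.
have hKl : K * (k1.+1%:R^-1 + l.+1%:R^-1) <= 2 * K * k1.+1%:R^-1.
  rewrite [2 * K]mulrC -mulrA ler_wpM2l//.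
  by move: hlk; move: (k1.+1%:R^-1 : R) (l.+1%:R^-1 : R) => u v; lra.
rewrite -/(S _ n).
have -> : x - S (fun i => limn (fun k => b k i)) n = (x - S (b k1) n) +
   ((S (b k1) n - S (b l) n) + (S (b l) n - S (fun i => limn (fun k => b k i)) n)).
  by rewrite subrKA subrKA.
apply: le_lt_trans (ler_normD _ _) _.
have := ler_normD (S (b k1) n - S (b l) n) (S (b l) n - S (fun i => limn (fun k => b k i)) n).
have : 0 < k1.+1%:R^-1 :> R by rewrite invr_gt0.
move: h1 hx hxl hl hKl; move: (k1.+1%:R^-1 : R) (l.+1%:R^-1 : R) => u v.
have -> : (3 + 2 * K) * u = 3 * u + 2 * (K * u) by ring.
have -> : 2 * K * u = 2 * (K * u) by ring.
move: (K * u) (K * (u + v)) => ku kuv.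
have arith (r1 r2 r3 r4 : R) : 3 * u + 2 * ku < eta / 2 -> r1 < u -> r2 <= kuv ->
    r3 < eta / 2 -> kuv <= 2 * ku -> 0 < u -> r4 <= r2 + r3 -> r1 + r4 < eta by lra.
exact: arith.
Qed.

Definition bcoef x i : R := biorth Num.norm e i x.

Lemma bcoefP x : is_sum Num.norm e (bcoef x) x.
Proof.
have [a ha] := sum_exists x.
exact: (@xgetPex _ (cst 0) (is_sum Num.norm e ^~ x)) (ex_intro _ a ha).
Qed.

Lemma bcoef_unique a x : is_sum Num.norm e a x -> bcoef x = a.
Proof. exact: sum_unique (bcoefP x). Qed.

Lemma bcoef_approx x (eta : R) : 0 < eta ->
  exists n0, forall n, (n0 <= n)%N -> `|x - S (bcoef x) n| < eta.
Proof. by have /is_sumS := bcoefP x; exact. Qed.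

Lemma bcoefD x y i : bcoef (x + y) i = bcoef x i + bcoef y i.
Proof.
have -> // : bcoef (x + y) = fun i => bcoef x i + bcoef y i.
apply: bcoef_unique; apply/is_sumS => eta eta0.
have e2 : 0 < eta / 2 by lra.
have [n1 h1] := bcoef_approx x e2; have [n2 h2] := bcoef_approx y e2.
exists (n1 + n2)%N => n nn; rewrite lincombD opprD addrACA.
rewrite (le_lt_trans (ler_normD _ _))// [eta]splitr ltrD// ?h1 ?h2//; lia.
Qed.

Lemma bcoefZ c x i : bcoef (c *: x) i = c * bcoef x i.
Proof.
have -> // : bcoef (c *: x) = fun i => c * bcoef x i.
apply: bcoef_unique; apply/is_sumS => eta eta0.
have c1 : 0 < `|c| + 1 by rewrite ltr_wpDl.
have [n1 h1] := bcoef_approx x (divr_gt0 eta0 c1).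
exists n1 => n /h1 nn; rewrite lincombZ -scalerBr normrZ.
rewrite (le_lt_trans (ler_wpM2l (normr_ge0 c) (ltW nn)))//.
by rewrite mulrCA -[ltRHS]mulr1 ltr_pM2l// ltr_pdivrMr// mul1r ltrDl.
Qed.

Lemma bcoefB x y i : bcoef (x - y) i = bcoef x i - bcoef y i.
Proof. by rewrite bcoefD -scaleN1r bcoefZ mulN1r. Qed.

Lemma bcoef_fset (A : {fset nat}) b i :
  bcoef (\sum_(j <- A) b j *: e j) i = b i * (i \in A)%:R.
Proof.
have -> // : bcoef (\sum_(j <- A) b j *: e j) = fun i => b i * (i \in A)%:R.
apply: bcoef_unique; apply/is_sumS => eta eta0.
have [n0 hn0] := fset_bounded A.
exists n0 => n nn; rewrite lincomb_fset sum_fset_all ?subrr ?normr0// => j jA.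
exact: leq_trans (hn0 _ jA) nn.
Qed.

Lemma multiplier_le x l n : (forall i, `|l i| <= 1) ->
  `|S (fun i => l i * bcoef x i) n| <= K * `|x|.
Proof.
move=> hl; apply/ler_addgt0Pr => eta eta0.
have K1 : 0 < K + 1 by rewrite ltr_wpDl.
have [n0 h0] := bcoef_approx x (divr_gt0 eta0 K1).
pose m := (n + n0)%N.
have -> : S (fun i => l i * bcoef x i) n =
    S (fun i => if (i < n)%N then l i * bcoef x i else 0) m.
  rewrite (@lincomb_trunc _ _ _ _ n m) ?leq_addr//; first by apply: eq_lincomb => i ->.
  by move=> i; rewrite leqNgt => /negbTE ->.
apply: (@le_trans _ _ (K * `|S (bcoef x) m|)).
  apply: uncond => i; case: ifP => _; last by rewrite normr0.
  by rewrite normrM ler_piMl.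
have hx : `|S (bcoef x) m| <= `|x| + eta / (K + 1).
  have -> : S (bcoef x) m = x - (x - S (bcoef x) m) by rewrite opprB addrC subrK.
  rewrite (le_trans (ler_normB _ _))// lerD2l ltW// h0// /m; lia.
apply: le_trans (ler_wpM2l K0 hx) _.
rewrite mulrDr lerD2l mulrCA -[leRHS]mulr1 ler_wpM2l ?(ltW eta0)//.
by rewrite ler_pdivrMr// mul1r lerDl.
Qed.

Lemma sum_bcoef_le x (A : {fset nat}) :
  \sum_(i <- A) `|bcoef x i| <= C * (#|` A|%:R) `^ q^-1 * `|x|.
Proof.
set D := C * _; have D0 : 0 <= D by rewrite mulr_ge0 ?powR_ge0.
apply/ler_addgt0Pr => eta eta0.
have D1 : 0 < D + 1 by rewrite ltr_wpDl.
have [n0 h0] := bcoef_approx x (divr_gt0 eta0 D1).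
have [n1 h1] := fset_bounded A.
pose m := (n1 + n0)%N; have := lower m A (bcoef x).
rewrite sum_fset_all => [|j jA]; last by rewrite (leq_trans (h1 _ jA))// leq_addr.
move=> /le_trans; apply; rewrite -/D.
have hx : `|S (bcoef x) m| <= `|x| + eta / (D + 1).
  have -> : S (bcoef x) m = x - (x - S (bcoef x) m) by rewrite opprB addrC subrK.
  rewrite (le_trans (ler_normB _ _))// lerD2l ltW// h0// /m; lia.
apply: le_trans (ler_wpM2l D0 hx) _.
rewrite mulrDr lerD2l mulrCA -[leRHS]mulr1 ler_wpM2l ?(ltW eta0)//.
by rewrite ler_pdivrMr// mul1r lerDl.
Qed.

Section newnorm.
Variable delta : R.
Hypotheses (delta0 : 0 < delta) (deltaC : delta * C <= 1).

(** Both [M] and [delta * u] are suprema of seminorms; taking one supremum over the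
    union of the two families gives their maximum. *)
Definition norm_family x : set R := [set r |
  (exists A : {fset nat}, r = (\sum_(i <- A) `|bcoef x i|) / #|` A|%:R `^ q^-1) \/
  (exists n l, (forall i, `|l i| <= 1) /\ r = delta * `|S (fun i => l i * bcoef x i) n|)].

Definition new_norm x : R := sup (norm_family x).

Lemma norm_family_ub x : ubound (norm_family x) ((C + delta * K) * `|x|).
Proof.
move=> r [[A ->]|[n [l [hl ->]]]].
  have [->|A0] := eqVneq A fset0.
    rewrite cardfs0 powR0 ?gt_eqF ?invr_gt0// invr0 mulr0.
    by rewrite mulr_ge0 ?addr_ge0 ?mulr_ge0 ?(ltW delta0).
  rewrite ler_pdivrMr; last by rewrite powR_gt0// ltr0n cardfs_gt0.
  apply: le_trans (sum_bcoef_le x A) _.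
  rewrite mulrAC ler_wpM2r ?powR_ge0// ler_wpM2r// lerDl mulr_ge0// ltW//.
rewrite mulrDl -[leLHS]add0r lerD ?mulr_ge0// -mulrA ler_wpM2l ?(ltW delta0)//.
exact: multiplier_le.
Qed.

Lemma new_norm_lower x (A : {fset nat}) :
  \sum_(i <- A) `|bcoef x i| <= #|` A|%:R `^ q^-1 * new_norm x.
Proof.
have [->|A0] := eqVneq A fset0.
  by rewrite big_seq_fset0 cardfs0 powR0 ?mul0r// gt_eqF// invr_gt0.
rewrite mulrC -ler_pdivrMr; last by rewrite powR_gt0// ltr0n cardfs_gt0.
apply: ub_le_sup; last by left; exists A.
by exists ((C + delta * K) * `|x|); exact: norm_family_ub.
Qed.

Lemma new_norm_mult x l n : (forall i, `|l i| <= 1) ->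
  delta * `|S (fun i => l i * bcoef x i) n| <= new_norm x.
Proof.
move=> hl; apply: ub_le_sup; last by right; exists n, l.
by exists ((C + delta * K) * `|x|); exact: norm_family_ub.
Qed.

Lemma new_norm_le x r :
  (forall A : {fset nat}, \sum_(i <- A) `|bcoef x i| <= #|` A|%:R `^ q^-1 * r) ->
  (forall l n, (forall i, `|l i| <= 1) -> delta * `|S (fun i => l i * bcoef x i) n| <= r) ->
  new_norm x <= r.
Proof.
move=> hA hl; apply: ge_sup.
  by exists (0 : R); left; exists fset0; rewrite big_seq_fset0 mul0r.
move=> s [[A ->]|[n [l [h ->]]]]; last exact: hl.
have [->|A0] := eqVneq A fset0.
  rewrite big_seq_fset0 mul0r.
  have := hl (fun=> 0) 0%N; rewrite lincomb0 !normr0 mulr0; exact.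
by rewrite ler_pdivrMr ?powR_gt0 ?ltr0n ?cardfs_gt0// mulrC.
Qed.

Lemma new_norm_ge0 x : 0 <= new_norm x.
Proof.
have := @new_norm_mult x (fun=> 0) 0; rewrite lincomb0 !normr0 mulr0; exact.
Qed.

Lemma new_normD x y : new_norm (x + y) <= new_norm x + new_norm y.
Proof.
apply: new_norm_le => [A|l n hl].
  rewrite mulrDr; apply: le_trans (lerD (new_norm_lower x A) (new_norm_lower y A)).
  by rewrite -big_split; apply: ler_sum => i _; rewrite bcoefD ler_normD.
apply: le_trans (lerD (new_norm_mult x n hl) (new_norm_mult y n hl)).
rewrite -mulrDr ler_wpM2l ?(ltW delta0)// (le_trans _ (ler_normD _ _))// -lincombD.
rewrite (@eq_lincomb _ _ _ _ (fun i => l i * bcoef x i + l i * bcoef y i)) // => i _.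
by rewrite bcoefD mulrDr.
Qed.

Lemma new_normZ_le c x : new_norm (c *: x) <= `|c| * new_norm x.
Proof.
apply: new_norm_le => [A|l n hl].
  rewrite mulrCA; apply: le_trans (ler_wpM2l (normr_ge0 c) (new_norm_lower x A)).
  by rewrite mulr_sumr; apply: ler_sum => i _; rewrite bcoefZ normrM.
apply: le_trans (ler_wpM2l (normr_ge0 c) (new_norm_mult x n hl)).
rewrite mulrCA -normrZ -lincombZ ler_wpM2l ?(ltW delta0)//.
rewrite (@eq_lincomb _ _ _ _ (fun i => c * (l i * bcoef x i))) // => i _.
by rewrite bcoefZ mulrCA.
Qed.

Lemma new_normZ c x : new_norm (c *: x) = `|c| * new_norm x.
Proof.
apply/eqP; rewrite eq_le new_normZ_le /=.
have [->|c0] := eqVneq c 0; first by rewrite normr0 mul0r new_norm_ge0.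
have := new_normZ_le c^-1 (c *: x); rewrite scalerA mulVf// scale1r normfV.
by rewrite ler_pdivlMl ?normr_gt0.
Qed.

Lemma new_norm0 : new_norm 0 = 0.
Proof. by rewrite -(scale0r (0 : X)) new_normZ normr0 mul0r. Qed.

Lemma new_norm_ge x : delta * `|x| <= new_norm x.
Proof.
apply/ler_addgt0Pr => eta eta0.
have [n0 h0] := bcoef_approx x (divr_gt0 eta0 delta0).
have h1 := h0 n0 (leqnn _).
have one1 (i : nat) : `|1 : R| <= 1 by rewrite normr1.
have h2 := @new_norm_mult x (fun=> 1) n0 one1.
rewrite (@eq_lincomb _ _ _ _ (bcoef x)) in h2 => [|i _]; last by rewrite mul1r.
have : `|x| <= `|x - S (bcoef x) n0| + `|S (bcoef x) n0|.
  by rewrite -{1}(subrK (S (bcoef x) n0) x) ler_normD.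
move=> /(ler_wpM2l (ltW delta0)) /le_trans; apply.
rewrite mulrDr addrC lerD// mulrC -ler_pdivlMr//; exact: ltW.
Qed.

Lemma new_norm_ub x : new_norm x <= (C + delta * K) * `|x|.
Proof.
apply: ge_sup; last exact: norm_family_ub.
by exists (0 : R); left; exists fset0; rewrite big_seq_fset0 mul0r.
Qed.

Lemma new_norm_equivalent : equivalent_norm new_norm.
Proof.
split.
  split; [exact: new_normD|exact: new_normZ|move=> x x0].
  have := new_norm_ge x; rewrite x0 pmulr_rle0// normr_le0 => /eqP//.
exists delta, (C + delta * K + 1); split => //.
  by rewrite ltr_wpDl// addr_ge0// mulr_ge0// ltW.
move=> x; rewrite new_norm_ge/=; apply: le_trans (new_norm_ub x) _.
by rewrite ler_wpM2r// lerDl.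
Qed.

Lemma is_sum_new_norm a x : is_sum new_norm e a x <-> is_sum Num.norm e a x.
Proof.
rewrite (is_sumP _ _ _ new_norm_ge0) (is_sumP _ _ _ (@normr_ge0 _ X)).
have B0 : 0 < C + delta * K + 1 by rewrite ltr_wpDl// addr_ge0// mulr_ge0// ltW.
split=> h eta eta0.
  have [n0 h0] := h _ (mulr_gt0 delta0 eta0).
  exists n0 => n /h0 hn; rewrite -(ltr_pM2l delta0); apply: le_lt_trans hn.
  exact: new_norm_ge.
have [n0 h0] := h _ (divr_gt0 eta0 B0).
exists n0 => n /h0 hn; apply: le_lt_trans (new_norm_ub _) _.
apply: (@le_lt_trans _ _ ((C + delta * K + 1) * `|x - \sum_(i < n) a i *: e i|)).
  by rewrite ler_wpM2r// lerDl.
by rewrite mulrC -ltr_pdivlMr.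
Qed.

Lemma biorth_new_norm i x : biorth new_norm e i x = bcoef x i.
Proof.
rewrite /bcoef /biorth; congr (xget _ _ i).
by apply/seteqP; split=> a /=; rewrite is_sum_new_norm.
Qed.

Lemma new_norm_schauder : schauder_basis new_norm e.
Proof.
move=> x; exists (bcoef x); split; first exact/is_sum_new_norm/bcoefP.
by move=> a /is_sum_new_norm; exact: bcoef_unique.
Qed.

Lemma new_norm_mono x y : (forall i, `|bcoef x i| <= `|bcoef y i|) -> new_norm x <= new_norm y.
Proof.
move=> xy; apply: new_norm_le => [A|l n hl].
  by apply: le_trans (new_norm_lower y A); apply: ler_sum => i _.
(* a zero denominator gives [k i = 0], which is correct since then [bcoef x i = 0] *)
pose k i := l i * (bcoef x i / bcoef y i).
have hk i : `|k i| <= 1.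
  rewrite /k normrM mulr_ile1// normrM normfV.
  have [->|y0] := eqVneq (bcoef y i) 0; first by rewrite normr0 invr0 mulr0.
  by rewrite ler_pdivrMr ?normr_gt0// mul1r.
apply: le_trans (new_norm_mult y n hk).
rewrite (@eq_lincomb _ _ _ _ (fun i => k i * bcoef y i))// => i _; rewrite /k.
have [y0|y0] := eqVneq (bcoef y i) 0; last by rewrite -mulrA divfK.
have := xy i; rewrite y0 normr0 normr_le0 => /eqP ->; by rewrite !mulr0.
Qed.

Lemma new_norm_unconditional : unconditional 1 new_norm e.
Proof.
move=> a b x y /is_sum_new_norm/bcoef_unique <- /is_sum_new_norm/bcoef_unique <- xy.
by rewrite mul1r; exact: new_norm_mono.
Qed.

Lemma powR_conjugate n : (n%:R : R) `^ q^-1 * n%:R `^ p^-1 = n%:R.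
Proof. by rewrite -powRD addrC pq ?oner_eq0// powRr1. Qed.

Lemma flat_le (A : {fset nat}) b t : 0 <= t -> (forall i, `|b i| <= t) ->
  `|\sum_(i <- A) b i *: e i| <= C * t * (#|` A|%:R) `^ p^-1.
Proof.
rewrite le_eqVlt => /predU1P[<- b0|t0 bt].
  rewrite big1 ?normr0 ?mulr0 ?mul0r// => i _.
  by have := b0 i; rewrite normr_le0 => /eqP ->; rewrite scale0r.
have -> : \sum_(i <- A) b i *: e i = t *: \sum_(i <- A) (b i / t) *: e i.
  rewrite scaler_sumr; apply: eq_bigr => i _; rewrite scalerA mulrCA mulfV ?gt_eqF//.
  by rewrite mulr1.
rewrite normrZ gtr0_norm// [C * t]mulrC -mulrA ler_wpM2l ?(ltW t0)//; apply: upper => i.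
by rewrite normrM normfV (gtr0_norm t0) ler_pdivrMr// mul1r.
Qed.

Lemma multiplier_flat_le (E : {fset nat}) a t n : 0 <= t -> (forall i, i \in E -> `|a i| <= t) ->
  `|S (fun i => a i * (i \in E)%:R) n| <= C * t * (#|` E|%:R) `^ p^-1.
Proof.
move=> t0 at_; rewrite lincomb_fset big_mkcond big_seq /=.
rewrite (eq_bigr (fun i => (a i * (i \in E)%:R * (i < n)%N%:R) *: e i)) => [|i iE]; last first.
  by rewrite iE mulr1; case: ifP; rewrite ?mulr1 ?mulr0 ?scale0r.
rewrite -big_seq; apply: flat_le => // i.
have [/at_ h|_] := boolP (i \in E); last by rewrite mulr0 mul0r normr0.
by rewrite mulr1; case: ltnP => _; rewrite ?mulr1// mulr0 normr0.
Qed.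

(** On a flat vector supported on [A], [M] counts [|F & A| <= |F|^(1/q) |A|^(1/p)] against
    each test set [F], and [deltaC] lets the upper estimate give the same bound for the
    multiplier part. *)
Lemma new_norm_flat (A : {fset nat}) b t : 0 <= t -> (forall i, i \in A -> `|b i| <= t) ->
  new_norm (\sum_(i <- A) b i *: e i) <= t * (#|` A|%:R) `^ p^-1.
Proof.
move=> t0 bt; have iq0 : 0 <= q^-1 by rewrite invr_ge0 ltW.
have ip0 : 0 <= p^-1 by rewrite invr_ge0 ltW.
apply: new_norm_le => [F|l n hl].
  apply: (@le_trans _ _ (t * #|` (F `&` A)%fset|%:R)).
    under eq_bigr do rewrite bcoef_fset normrM normr_nat.
    rewrite (bigID (fun i => i \in A))/= addrC big1 ?add0r => [|i /negbTE ->];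
      last by rewrite mulr0.
    rewrite sum_fsetI; apply: ler_sum_card => i; rewrite inE => /andP[_ iA].
    by rewrite iA mulr1 bt.
  rewrite mulrCA ler_wpM2l// -(powR_conjugate #|` (F `&` A)%fset|).
  by apply: ler_pM; rewrite ?powR_ge0//; apply: ge0_ler_powR; rewrite ?nnegrE// ler_nat;
    apply: fsubset_leq_card; rewrite ?fsubsetIl ?fsubsetIr.
rewrite (@eq_lincomb _ _ _ _ (fun i => (l i * b i) * (i \in A)%:R)) => [|i _]; last first.
  by rewrite bcoef_fset mulrA.
apply: le_trans (ler_wpM2l (ltW delta0) (@multiplier_flat_le A (fun i => l i * b i) t n t0 _)) _.
  by move=> i /bt iA; rewrite normrM (le_trans _ iA)// ler_piMl.
by rewrite !mulrA ler_wpM2r ?powR_ge0// ler_piMl.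
Qed.

Lemma new_norm_normalized : normalized new_norm e.
Proof.
move=> i; have E : e i = \sum_(j <- [fset i]%fset) 1 *: e j.
  by rewrite big_seq_fset1 scale1r.
apply/eqP; rewrite eq_le; apply/andP; split.
  have := @new_norm_flat [fset i]%fset (fun=> 1) 1 ler01 (fun _ _ => _).
  by rewrite -E cardfs1 powR1 mulr1; apply; rewrite normr1.
have := new_norm_lower (e i) [fset i]%fset.
by rewrite big_seq_fset1 cardfs1 powR1 mul1r {1}E bcoef_fset !inE eqxx mulr1 normr1.
Qed.

Lemma new_norm_bidemocratic : bidemocratic 1 new_norm e.
Proof.
move=> n n0.
have iq0 : 0 <= q^-1 by rewrite invr_ge0 ltW.
have ip0 : 0 <= p^-1 by rewrite invr_ge0 ltW.
have hF : (fundamental new_norm e n <= (n%:R `^ p^-1)%:E)%E.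
  apply: ge_ereal_sup => _ [A /= An <-]; rewrite lee_fin.
  have -> : \sum_(i <- A) e i = \sum_(i <- A) 1 *: e i.
    by apply: eq_bigr => i _; rewrite scale1r.
  apply: le_trans (@new_norm_flat A (fun=> 1) 1 ler01 _) _ => [i _|]; first by rewrite normr1.
  by rewrite mul1r; apply: ge0_ler_powR; rewrite ?nnegrE// ler_nat.
have hDual : (dual_fundamental new_norm e n <= (n%:R `^ q^-1)%:E)%E.
  apply: ge_ereal_sup => _ [A /= An <-].
  apply: ge_ereal_sup => _ [x /= x1 <-]; rewrite lee_fin.
  apply: (@le_trans _ _ (\sum_(i <- A) `|bcoef x i|)).
    by apply: le_trans (ler_norm_sum _ _ _) _; apply: ler_sum => i _; rewrite biorth_new_norm.
  apply: le_trans (new_norm_lower x A) _.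
  apply: (@le_trans _ _ (#|` A|%:R `^ q^-1)); first by rewrite ler_piMr ?powR_ge0.
  by apply: ge0_ler_powR; rewrite ?nnegrE// ler_nat.
have F0 : (0 <= fundamental new_norm e n)%E.
  apply: ereal_sup_ubound; exists fset0 => //=.
  by rewrite big_seq_fset0 new_norm0.
have D0 : (0 <= dual_fundamental new_norm e n)%E.
  apply: (@le_trans _ _ (dual_norm new_norm (fun x => \sum_(i <- fset0) biorth new_norm e i x))).
    apply: ereal_sup_ubound; exists 0 => /=.
      by rewrite new_norm0.
    by rewrite big_seq_fset0 normr0.
  by apply: ereal_sup_ubound; exists fset0.
apply: le_trans (lee_pmul F0 D0 hF hDual) _.
by rewrite -EFinM lee_fin mul1r mulrC powR_conjugate.
Qed.

(** Coefficients of modulus at least [t] on [G \ A] are erased, and those on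
    [A \ G] are replaced by coefficients of modulus at most [t].  The sums in [M] do
    not grow, since indices of [A \ G] can be exchanged for indices of [G \ A]; the
    multiplier part grows by a flat vector of size [|A \ G|], and [upper] bounds it
    by [C * t * |G \ A|^(1/p)], hence by [C * M z]. *)
Lemma new_norm_swap (A G : {fset nat}) t w z : 0 <= t -> (#|` A| <= #|` G|)%N ->
  (forall i, i \in G -> bcoef w i = 0) ->
  (forall i, i \notin G -> `|bcoef w i| <= t) ->
  (forall i, i \notin G -> i \notin A -> bcoef w i = bcoef z i) ->
  (forall i, i \in G -> i \notin A -> t <= `|bcoef z i|) ->
  new_norm w <= (1 + delta * C) * new_norm z.
Proof.
move=> t0 AG wG wt wz zt.
have iq0 : 0 <= q^-1 by rewrite invr_ge0 ltW.
have ip0 : 0 <= p^-1 by rewrite invr_ge0 ltW.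
pose E := (A `\` G)%fset; pose H := (G `\` A)%fset.
have EH : (#|` E| <= #|` H|)%N.
  by rewrite /E /H !cardfsD fsetIC; exact: leq_sub2r.
have N0 := new_norm_ge0 z.
have dC0 : 0 <= delta * C by rewrite mulr_ge0// ltW.
apply: new_norm_le => [F|l n hl].
  apply: (@le_trans _ _ (#|` F|%:R `^ q^-1 * new_norm z)); last first.
    by rewrite ler_wpM2l ?powR_ge0// ler_peMl// lerDl.
  (* The part [D] of [F] inside [A] minus [G] is exchanged for a set [B] of the
     same size inside [G] minus [A], where the coefficients of [z] are larger. *)
  pose D := (F `&` E)%fset; pose F1 := (F `\` (A `|` G))%fset.
  have DE : (#|` D| <= #|` E|)%N by rewrite fsubset_leq_card// fsubsetIr.
  have [B BH BD] := subfset_card (leq_trans DE EH).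
  have dB : [disjoint F1 & B]%fset.
    apply/fdisjointP => i; rewrite !inE negb_or => /andP[/andP[iA iG] _].
    by apply/negP => /(fsubsetP BH); rewrite !inE (negbTE iG) andbF.
  have dD : [disjoint F1 & D]%fset.
    apply/fdisjointP => i; rewrite !inE negb_or => /andP[/andP[iA iG] _].
    by rewrite (negbTE iA) !andbF.
  have cF : (#|` (F1 `|` B)%fset| <= #|` F|)%N.
    have cU (U V : {fset nat}) : [disjoint U & V]%fset ->
        #|` (U `|` V)%fset| = (#|` U| + #|` V|)%N.
      by move=> UV; rewrite cardfsU disjoint_fsetI0// cardfs0 subn0.
    rewrite cU// BD -cU//; apply: fsubset_leq_card; rewrite fsubUset fsubDset.
    by rewrite fsubsetIl fsubsetUr.
  apply: (@le_trans _ _ (\sum_(i <- (F1 `|` B)%fset) `|bcoef z i|)); last first.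
    apply: le_trans (new_norm_lower z _) _; rewrite ler_wpM2r//.
    by apply: ge0_ler_powR; rewrite ?nnegrE// ler_nat.
  rewrite sum_fsetU_disjoint//.
  have -> : \sum_(i <- F) `|bcoef w i| = \sum_(i <- F1) `|bcoef w i| + \sum_(i <- D) `|bcoef w i|.
    rewrite -sum_fsetU_disjoint// (bigID (fun i => i \in G))/= big1 ?add0r => [|i /wG ->];
      last first.
      by rewrite normr0.
    rewrite -big_filter; apply: perm_big; apply: uniq_perm; rewrite ?filter_uniq ?fset_uniq//.
    move=> i; rewrite mem_filter !inE negb_or.
    by case: (i \in A); case: (i \in G); case: (i \in F).
  apply: lerD.
    rewrite big_seq [leRHS]big_seq; apply: ler_sum => i.
    by rewrite !inE negb_or => /andP[/andP[iA iG] _]; rewrite wz.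
  apply: (@le_trans _ _ (t * #|` D|%:R)).
    by apply: ler_sum_card => i; rewrite !inE => /andP[_ /andP[iG _]]; exact: wt.
  rewrite -BD; apply: ger_sum_card => i /(fsubsetP BH); rewrite !inE => /andP[iA iG].
  exact: zt.
have tH : t * #|` H|%:R `^ p^-1 <= new_norm z.
  have [->|H0] := eqVneq H fset0.
    by rewrite cardfs0 powR0 ?mulr0// gt_eqF// invr_gt0.
  have cH : 0 < #|` H|%:R `^ q^-1 :> R by rewrite powR_gt0// ltr0n cardfs_gt0.
  rewrite -(ler_pM2l cH) mulrCA powR_conjugate; apply: le_trans (new_norm_lower z H).
  by apply: ger_sum_card => i; rewrite !inE => /andP[iA iG]; exact: zt.
(* [w] is split into a multiplier of [z] and a flat vector on [E] *)
pose l1 i := if i \in A then 0 else if i \in G then 0 else l i.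
have hl1 i : `|l1 i| <= 1 by rewrite /l1; do 2 (case: ifP => _; rewrite ?normr0//).
rewrite (@eq_lincomb _ _ _ _ (fun i =>
    l1 i * bcoef z i + (l i * bcoef w i) * (i \in E)%:R)) => [|i _]; last first.
  rewrite /l1 !inE; case iA: (i \in A); case iG: (i \in G) => /=.
  - by rewrite wG// !mulr0 mul0r addr0.
  - by rewrite mul0r add0r mulr1.
  - by rewrite wG// !mulr0 mul0r addr0.
  - by rewrite mulr0 addr0 wz ?iA ?iG.
rewrite lincombD mulrDl mul1r; apply: le_trans (ler_wpM2l (ltW delta0) (ler_normD _ _)) _.
rewrite mulrDr lerD//; first exact: new_norm_mult.
rewrite -mulrA ler_wpM2l ?(ltW delta0)//.
apply: le_trans (@multiplier_flat_le E (fun i => l i * bcoef w i) t n t0 _) _.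
  by move=> i; rewrite !inE => /andP[iG _]; rewrite normrM (le_trans _ (wt _ iG))// ler_piMl.
rewrite -mulrA ler_wpM2l//; apply: le_trans tH; rewrite ler_wpM2l//.
by apply: ge0_ler_powR; rewrite ?nnegrE// ler_nat.
Qed.

Lemma new_norm_greedy : greedy (1 + delta * C) new_norm e.
Proof.
move=> x rho; have -> : (fun i => biorth new_norm e i x) = bcoef x.
  by apply/funext => i; exact: biorth_new_norm.
move=> [rinj rdec rgreedy] [//|m] _.
have dC1 : 0 < 1 + delta * C by rewrite ltr_pwDl// mulr_ge0// ltW.
rewrite mulrC -ler_pdivrMr//; apply: lb_le_inf.
  by exists (new_norm (x - 0)), fset0, (fun=> 0); rewrite cardfs0 big_seq_fset0.
move=> _ [A [a [Am ->]]]; rewrite ler_pdivrMr// mulrC.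
pose s := [seq rho k | k <- iota 0 m.+1].
have us : uniq s by rewrite map_inj_uniq// iota_uniq.
pose G := [fset i in s]%fset.
have cG : #|` G| = m.+1 by rewrite card_fseq undup_id// size_map size_iota.
have GE : greedy_sum new_norm e rho m.+1 x = \sum_(i <- G) bcoef x i *: e i.
  have -> : \sum_(i <- G) bcoef x i *: e i = \sum_(i <- s) bcoef x i *: e i.
    apply: perm_big; apply: uniq_perm; rewrite ?fset_uniq// => i.
    by rewrite !inE.
  rewrite big_map -[m.+1 in RHS]subn0 -/(index_iota 0 m.+1) big_mkord.
  by apply: eq_bigr => k _; rewrite biorth_new_norm.
have memG i : reflect (exists2 k, (k <= m)%N & i = rho k) (i \in G).
  have -> : (i \in G) = (i \in s) by rewrite !inE.
  apply: (iffP idP) => [/mapP[k]|[k km ->]].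
    by rewrite mem_iota => km ->; exists k.
  by apply: map_f; rewrite mem_iota.
have anti k l : (k <= l)%N -> `|bcoef x (rho l)| <= `|bcoef x (rho k)|.
  by elim: l => [|l IH]; [rewrite leqn0 => /eqP ->|rewrite leq_eqVlt =>
     /predU1P[->//|/IH]; exact: le_trans (rdec _)].
(* [rho m] is the last index selected, so [t] is the least modulus on [G] *)
rewrite GE; apply: (@new_norm_swap A G `|bcoef x (rho m)|) => //.
- by rewrite cG.
- by move=> i iG; rewrite bcoefB bcoef_fset iG mulr1 subrr.
- move=> i iG; rewrite bcoefB bcoef_fset (negbTE iG) mulr0 subr0.
  apply: rgreedy => k km E; move/memG: iG; apply; exists k => //.
- by move=> i iG iA; rewrite !bcoefB !bcoef_fset (negbTE iG) (negbTE iA) !mulr0.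
- move=> i /memG[k km ->] iA; rewrite bcoefB bcoef_fset (negbTE iA) mulr0 subr0.
  exact: anti.
Qed.

End newnorm.

(** The parameter [delta] is chosen with [delta * C <= 1], for normalization and
    bidemocracy, and with [delta * C <= eps], for the greedy constant. *)
Theorem bidemocratic_renorming (eps : R) : 0 < eps ->
  exists N : X -> R, equivalent_norm N /\ schauder_basis N e /\ normalized N e /\
    unconditional 1 N e /\ bidemocratic 1 N e /\ greedy (1 + eps) N e.
Proof.
move=> eps0; pose delta := Num.min 1 eps / (C + 1).
have C1 : 0 < C + 1 by rewrite ltr_wpDl.
have delta0 : 0 < delta by rewrite divr_gt0// lt_min ltr01.
have dC : delta * C <= Num.min 1 eps.
  by rewrite /delta mulrAC ler_pdivrMr// ler_wpM2l ?lerDl// le_min ler01 ltW.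
have dC1 : delta * C <= 1 by rewrite (le_trans dC)// ge_min lexx.
exists (new_norm delta); split; first exact: new_norm_equivalent.
split; first exact: new_norm_schauder.
split; first exact: new_norm_normalized.
split; first exact: new_norm_unconditional.
split; first exact: new_norm_bidemocratic.
move=> x rho hr m m0; apply: le_trans (new_norm_greedy delta0 hr m0) _.
have h : 1 + delta * C <= 1 + eps by rewrite lerD2l (le_trans dC)// ge_min lexx orbT.
apply: ler_wpM2r => //; apply: lb_le_inf.
  by exists (new_norm delta (x - 0)), fset0, (fun=> 0); rewrite cardfs0 big_seq_fset0.
by move=> _ [A [a [_ ->]]]; exact: new_norm_ge0.
Qed.

End renorm.

(** * Simple functions are dense in L_p *)
Section Lp_density.
Context d (T : measurableType d) (R : realType).
Variables (mu : {finite_measure set T -> \bar R}) (p : R) (p1 : 1 <= p).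
Let pE : (1 <= p%:E)%E := p1.
Let L := LfunType mu pE.
Let X := Lp mu pE.
Implicit Types f g : L.

Let p0 : 0 < p. Proof. exact: lt_le_trans p1. Qed.

Lemma LfunDE f g x : (f + g) x = f x + g x. Proof. by []. Qed.

Lemma LfunBE f g x : (f - g) x = f x - g x. Proof. by []. Qed.

Lemma LfunZE c f x : (c *: f) x = c * f x. Proof. by []. Qed.

Lemma Lfun0E x : (0 : L) x = 0. Proof. by []. Qed.

Lemma Lfun_sumE (I : Type) (r : seq I) (P : pred I) (F : I -> L) x :
  (\sum_(i <- r | P i) F i) x = \sum_(i <- r | P i) F i x.
Proof. exact: (big_morph (fun f : L => f x) (fun f g => LfunDE f g x) (Lfun0E x)). Qed.

Lemma measurable_powR_norm (h : T -> R) : measurable_fun setT h ->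
  measurable_fun setT (fun x => (`|h x| `^ p)%:E).
Proof.
move=> mh; apply/measurable_EFinP.
by apply: (measurableT_comp (measurable_powR p)); exact: measurableT_comp.
Qed.

Lemma Lfun_dominated (h : T -> R) f : measurable_fun setT h ->
  (forall x, `|h x| <= `|f x|) -> h \in Lfun mu p%:E.
Proof.
move=> mh hf; apply/andP; split; rewrite inE//= /finite_norm.
have : ('N[mu]_p%:E[EFin \o (f : T -> R)] < +oo)%E := Lfunction_finite pE f.
apply: le_lt_trans; rewrite unlock /Lnorm.
apply: gt0_ler_poweR; first by rewrite invr_ge0 ltW.
- by rewrite in_itv/= leey andbT integral_ge0// => x _; exact: poweR_ge0.
- by rewrite in_itv/= leey andbT integral_ge0// => x _; exact: poweR_ge0.
apply: ge0_le_integral => //.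
- by move=> x _; exact: poweR_ge0.
- exact: measurable_powR_norm.
- exact: measurable_powR_norm.
- by move=> x _ /=; rewrite lee_fin ge0_ler_powR ?nnegrE// ltW.
Qed.

Lemma Lp_norm_powR f : (`|\pi_X f| `^ p)%:E = (\int[mu]_x (`|f x| `^ p)%:E)%E.
Proof.
rewrite Lp_normE -poweR_EFin fineK.
  by rewrite (poweR_Lnorm _ _ (lt0r_neq0 p0)).
rewrite ge0_fin_numE ?Lnorm_ge0//; exact: Lfunction_finite.
Qed.

Lemma Lfun_indic_fin (A : set T) : measurable A -> (\1_A : T -> R) \in Lfun mu p%:E.
Proof.
move=> mA; pose one : L := Lfun_Sub pE (Lfun_cst mu 1 p).
apply: (@Lfun_dominated _ one); first exact: measurable_indic.
by move=> x; rewrite /= normr1 indicE normr_nat lern1 leq_b1.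
Qed.

Definition indic_Lfun (A : set T) (mA : measurable A) : L := Lfun_Sub pE (Lfun_indic_fin mA).

Lemma indic_LfunE A (mA : measurable A) x : indic_Lfun mA x = \1_A x. Proof. by []. Qed.

Lemma norm_indic_Lfun A (mA : measurable A) : (`|\pi_X (indic_Lfun mA)| `^ p)%:E = mu A.
Proof.
rewrite Lp_norm_powR (eq_integral (fun x => (\1_A x)%:E)) ?integral_indic ?setIT//.
move=> x _; rewrite indic_LfunE indicE; case: (x \in A) => /=.
  by rewrite normr1 powR1.
by rewrite normr0 powR0 ?gt_eqF.
Qed.

Section closed_subspace.
Variable V : set X.
Hypothesis VD : forall x y, V x -> V y -> V (x + y).
Hypothesis VZ : forall (c : R) x, V x -> V (c *: x).
Hypothesis Vlim : forall x, (forall eta : R, 0 < eta -> exists2 y, V y & `|x - y| < eta) -> V x.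
Hypothesis Vind : forall A (mA : measurable A), V (\pi_X (indic_Lfun mA)).

Lemma V_zero : V 0.
Proof. by rewrite -(scale0r (\pi_X (indic_Lfun measurableT))); exact: VZ. Qed.

Lemma V_sum (I : Type) (r : seq I) (P : pred I) (F : I -> X) :
  (forall i, P i -> V (F i)) -> V (\sum_(i <- r | P i) F i).
Proof. by move=> h; apply: big_ind => //; exact: V_zero. Qed.

Lemma V_simple (g : {nnsfun T >-> R}) f : (f : T -> R) =1 g -> V (\pi_X f).
Proof.
move=> fg; pose s := fset_set ((g : T -> R) @` setT).
have mi i : measurable (g @^-1` [set s`_i]) by [].
have -> : f = \sum_(i < #|` s|) s`_i *: indic_Lfun (mi i).
  by apply/LfuneqP => x; rewrite fg Lfun_sumE fimfunEord.
rewrite raddf_sum; apply: V_sum => i _; rewrite /= Lp_piZ.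
exact/VZ/Vind.
Qed.

(** Dominated convergence along an increasing sequence of simple functions, with the
    [p]-th power of the function as dominating function. *)
Lemma V_nonneg f : (forall x, 0 <= f x) -> V (\pi_X f).
Proof.
move=> f0; apply: Vlim => eta eta0.
have mf : measurable_fun setT (f : T -> R) by [].
have mEf : measurable_fun setT (EFin \o f) by exact/measurable_EFinP.
have Ef0 x : [set: T] x -> (0 <= (EFin \o f) x)%E by move=> _; rewrite lee_fin.
pose g n := nnsfun_approx measurableT mEf n.
have gf n x : 0 <= g n x <= f x.
  by rewrite fun_ge0 /= -lee_fin nnsfun_approxE; apply: le_approx.
have gL n : (g n : T -> R) \in Lfun mu p%:E.
  apply: (@Lfun_dominated _ f) => // x; have /andP[g0 gx] := gf n x.
  by rewrite !ger0_norm.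
pose G n : L := Lfun_Sub pE (gL n).
pose F n x : \bar R := (`|f x - g n x| `^ p)%:E.
have mF n : measurable_fun setT (F n).
  by apply: (@measurable_powR_norm (fun x => f x - g n x)); exact: measurable_funB.
have Fcvg : {ae mu, forall x, setT x -> F ^~ x @ \oo --> 0%E}.
  apply: nearW => x _.
  have : (EFin \o (fun n => g n x)) @ \oo --> (f x)%:E by exact: cvg_nnsfun_approx.
  move=> /fine_cvgP[_ /cvgrPdist_lt gx].
  apply/fine_cvgP; split; first exact: nearW.
  apply/cvgrPdist_lt => e e0 /=.
  have ep0 : 0 < e `^ p^-1 by exact: powR_gt0.
  move/(_ _ ep0): gx; apply: filterS => n /= h.
  rewrite sub0r normrN ger0_norm ?powR_ge0//.
  have -> : e = (e `^ p^-1) `^ p by rewrite -powRrM mulVf ?gt_eqF// powRr1// ltW.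
  by apply: gt0_ltr_powR; rewrite ?nnegrE// ltW.
have fint : mu.-integrable setT (fun x => (`|f x| `^ p)%:E).
  by apply: Lfun_integrable => //; exact: LfunP.
have Fdom : {ae mu, forall x n, setT x -> (`|F n x| <= (`|f x| `^ p)%:E)%E}.
  apply: nearW => x n _; rewrite gee0_abs ?lee_fin ?powR_ge0//.
  have /andP[g0 gx] := gf n x.
  rewrite ge0_ler_powR ?nnegrE ?(ltW p0)//.
  by rewrite !ger0_norm ?subr_ge0// lerBlDr lerDl.
have [_ _] := dominated_convergence measurableT mF (measurable_cst _) Fcvg fint Fdom.
rewrite integral0 => /fine_cvgP[_ /cvgrPdist_lt /(_ (eta `^ p) (powR_gt0 _ eta0))].
move=> [n _ /(_ n (leqnn _))] /= h.
exists (\pi_X (G n)); first exact: (@V_simple (g n)).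
have E := Lp_norm_powR (f - G n).
move: h; rewrite sub0r normrN.
rewrite (eq_integral (fun x => (`|(f - G n) x| `^ p)%:E))// -E /=.
rewrite ger0_norm ?powR_ge0// raddfB /= => h.
have h' : `|\pi_X f - \pi_X (G n)| `^ p < eta `^ p by [].
rewrite ltNge; apply/negP => /(ge0_ler_powR (ltW p0)).
by rewrite !nnegrE => /(_ (ltW eta0) (normr_ge0 _)); rewrite leNgt h'.
Qed.

(** A closed linear subspace of [L_p] that contains the indicators of all measurable
    sets is the whole space. *)
Lemma closed_subspace_full x : V x.
Proof.
rewrite -[x]reprK; set f : L := repr x.
have mf : measurable_fun setT (f : T -> R) by [].
have pL : (f : T -> R)^\+ \in Lfun mu p%:E.
  apply: (@Lfun_dominated _ f); first exact: measurable_funrpos.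
  by move=> t; rewrite /funrpos ger0_norm ?le_max ?lexx ?orbT// ge_max ler_norm normr_ge0.
have nL : (f : T -> R)^\- \in Lfun mu p%:E.
  apply: (@Lfun_dominated _ f); first exact: measurable_funrneg.
  move=> t; rewrite /funrneg ger0_norm ?le_max ?lexx ?orbT// ge_max normr_ge0.
  by rewrite -normrN ler_norm.
pose fp : L := Lfun_Sub pE pL; pose fn : L := Lfun_Sub pE nL.
have -> : f = fp + (-1) *: fn.
  apply/LfuneqP => t; rewrite LfunDE LfunZE mulN1r /= /funrpos /funrneg.
  have [ft|ft] := leP (f t) 0.
    by rewrite max_l ?oppr_ge0// sub0r opprK.
  by rewrite max_r ?subr0// oppr_le0 ltW.
rewrite raddfD /= Lp_piZ; apply: VD; last apply: VZ; apply: V_nonneg => t.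
  by rewrite /= /funrpos le_max lexx orbT.
by rewrite /= /funrneg le_max lexx orbT.
Qed.

End closed_subspace.
End Lp_density.

(** * The Haar system in L_p *)
Section dyadic.
Variable R : realType.
Local Notation mu := (@lebesgue01 R).

Definition dyad (m j : nat) : set (measurableTypeR R) :=
  `[j%:R / 2 ^+ m, j.+1%:R / 2 ^+ m[%classic.

Lemma dyadP m j (x : R) : dyad m j x <-> j%:R <= x * 2 ^+ m < j.+1%:R.
Proof.
have m0 : 0 < 2 ^+ m :> R by rewrite exprn_gt0.
by rewrite /dyad /= in_itv /= ler_pdivrMr// ltr_pdivlMr.
Qed.

Lemma measurable_dyad m j : measurable (dyad m j).
Proof. exact: measurable_itv. Qed.

Lemma dyad_inj m i j (x : R) : dyad m i x -> dyad m j x -> i = j.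
Proof.
move=> /dyadP/andP[a b] /dyadP/andP[c d].
have : (i < j.+1)%N by rewrite -(ltr_nat R) (le_lt_trans a).
have : (j < i.+1)%N by rewrite -(ltr_nat R) (le_lt_trans c).
lia.
Qed.

Lemma dyad_half m j (x : R) : dyad m.+1 j x -> dyad m j./2 x.
Proof.
move=> /dyadP/andP[a b]; apply/dyadP; rewrite exprS mulrCA in a b.
have h1 : (j./2.*2)%:R <= j%:R :> R by rewrite ler_nat; lia.
have h2 : j.+1%:R <= (j./2.+1.*2)%:R :> R by rewrite ler_nat; lia.
move: h1 h2; rewrite -!mul2n !natrM => h1 h2.
apply/andP; split.
  by rewrite -(@ler_pM2l _ 2)// (le_trans h1).
by rewrite -(@ltr_pM2l _ 2)// (lt_le_trans b).
Qed.

Lemma indic_dyad m i j (x : R) : dyad m j x -> \1_(dyad m i) x = (i == j)%:R :> R.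
Proof.
move=> xj; rewrite indicE; case: eqP => [->|ij]; first by rewrite mem_set.
by rewrite memNset// => xi; apply: ij; exact: dyad_inj xi xj.
Qed.

Lemma indic_dyad_split m j (x : R) :
  \1_(dyad m j) x = \1_(dyad m.+1 j.*2) x + \1_(dyad m.+1 j.*2.+1) x :> R.
Proof.
have [xj|xj] := pselect (dyad m j x); last first.
  rewrite !indicE !memNset ?addr0//.
  - by move=> /dyad_half; rewrite -[_./2]/(uphalf _) uphalf_double.
  - by move=> /dyad_half; rewrite doubleK.
have : dyad m.+1 j.*2 x \/ dyad m.+1 j.*2.+1 x.
  move: xj => /dyadP/andP[a b].
  have [h|h] := ltP (x * 2 ^+ m.+1) (j.*2.+1)%:R; [left|right]; apply/dyadP; rewrite h ?andbT /=.
    by rewrite exprS mulrCA -mul2n natrM ler_pM2l.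
  by rewrite exprS mulrCA -doubleS -mul2n natrM ltr_pM2l.
rewrite (indic_dyad _ xj) eqxx => -[] h; rewrite !(indic_dyad _ h) eqxx.
  by rewrite (_ : (_ == _) = false) ?addr0//; apply/eqP; lia.
by rewrite (_ : (_ == _) = false) ?add0r//; apply/eqP; lia.
Qed.

(** The Haar function on a dyadic interval of generation [m] is the difference of the
    indicators of its two halves, which belong to generation [m + 1]. *)
Lemma haar_fun_node m l (x : R) : (l < 2 ^ m)%N ->
  @haar_fun R (2 ^ m + l) x = \1_(dyad m.+1 l.*2) x - \1_(dyad m.+1 l.*2.+1) x.
Proof.
move=> lm; rewrite /haar_fun.
have : (0 < 2 ^ m + l)%N by rewrite addn_gt0 expn_gt0.
case E : (2 ^ m + l)%N => [|n] // _; rewrite -E trunc_log_node// addKn.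
have m0 : 2 ^+ m != 0 :> R by rewrite expf_neq0.
have E1 : l%:R / 2 ^+ m = (l.*2)%:R / 2 ^+ m.+1 :> R.
  by rewrite -mul2n natrM exprS; field.
have E2 : l.+1%:R / 2 ^+ m = (l.*2.+2)%:R / 2 ^+ m.+1 :> R.
  by rewrite -doubleS -mul2n natrM exprS; field.
have E3 : (l%:R / 2 ^+ m + l.+1%:R / 2 ^+ m) / 2 = (l.*2.+1)%:R / 2 ^+ m.+1 :> R.
  by rewrite -!natr1 -mul2n natrM exprS; field.
by rewrite E3 E1 E2.
Qed.

Lemma haar_sum_dyad (b : nat -> R) m j (x : R) : (j < 2 ^ m)%N -> dyad m j x ->
  \sum_(0 <= i < 2 ^ m) b i * @haar_fun R i x = node_value b m j.
Proof.
elim: m j => [|m IH] j jm xj; first by rewrite expn0 big_nat1 /= mulr1.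
have jm2 : (j./2 < 2 ^ m)%N by move: jm; rewrite expnS; lia.
rewrite sum_levelS (IH j./2) //=; last exact: dyad_half.
congr (_ + _).
rewrite (eq_big_nat _ _ (F2 := fun l => b (2 ^ m + l)%N * ((l.*2 == j)%:R - (l.*2.+1 == j)%:R))).
  rewrite big_mkord (bigD1 (Ordinal jm2))//= big1 ?addr0 => [|l /eqP lj].
    rewrite mulrC; congr (_ * _); have := odd_double_half j.
    case: (odd j) => /= jE.
      rewrite (_ : (j./2.*2 == j) = false); last by apply/eqP; lia.
      by rewrite (_ : (j./2.*2.+1 == j) = true) ?sub0r//; apply/eqP; lia.
    rewrite (_ : (j./2.*2 == j) = true); last by apply/eqP; lia.
    by rewrite (_ : (j./2.*2.+1 == j) = false) ?subr0//; apply/eqP; lia.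
  have lj' : nat_of_ord l != j./2 by apply/eqP => E; apply: lj; exact: val_inj.
  rewrite (_ : (l.*2 == j) = false); last by apply/eqP; lia.
  by rewrite (_ : (l.*2.+1 == j) = false) ?subrr ?mulr0//; apply/eqP; lia.
by move=> l /andP[_ lm]; rewrite haar_fun_node// !(indic_dyad _ xj).
Qed.

Lemma lebesgue01_dyad m j : (j < 2 ^ m)%N -> mu (dyad m j) = ((2 ^+ m)^-1)%:E.
Proof.
move=> jm; have m0 : 0 < 2 ^+ m :> R by rewrite exprn_gt0.
rewrite /lebesgue01 /mrestr setIidl; last first.
  move=> x /dyadP/andP[a b]; rewrite /= in_itv/= -(pmulr_lge0 _ m0) (le_trans _ a)//=.
  by rewrite -(ler_pM2r m0) mul1r (le_trans (ltW b))// -natrX ler_nat.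
rewrite /dyad lebesgue_measure_itv /= lte_fin ltr_pM2r ?invr_gt0// ltr_nat ltnSn.
by rewrite -EFinB -mulrBl -natrB// subSnn mul1r.
Qed.

Lemma lebesgue01_null (A : set (measurableTypeR R)) : measurable A ->
  A `&` `[0, 1[ = set0 -> mu A = 0%E.
Proof.
move=> mA A0; rewrite /lebesgue01 /mrestr.
apply/eqP; rewrite -measure_le0 -(@lebesgue_measure_set1 R 1); apply: le_measure.
- by rewrite inE; apply: measurableI => //; exact: measurable_itv.
- by rewrite inE.
- move=> x [Ax]; rewrite /= in_itv/= => /andP[x0 x1]; apply/eqP; rewrite eq_le x1/= leNgt.
  apply/negP => x1'; suff : set0 x by [].
  by rewrite -A0; split => //=; rewrite in_itv/= x0.
Qed.

Lemma dyad_exists m (x : R) : 0 <= x < 1 -> exists2 j, (j < 2 ^ m)%N & dyad m j x.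
Proof.
move=> /andP[x0 x1]; have m0 : 0 < 2 ^+ m :> R by rewrite exprn_gt0.
have y0 : 0 <= x * 2 ^+ m by rewrite mulr_ge0// ltW.
have tr := truncn_itv y0.
exists (Num.truncn (x * 2 ^+ m)); last exact/dyadP.
have /andP[tr0 _] := tr; rewrite -(ltr_nat R) (le_lt_trans tr0)// natrX.
by rewrite -[ltRHS]mul1r ltr_pM2r.
Qed.

End dyadic.

Section haar_Lp.
Variables (R : realType) (p : R) (p1 : 1 <= p).
Local Notation mu := (@lebesgue01 R).
Let pE : (1 <= p%:E)%E := p1.
Let L := LfunType mu pE.
Let X := Lp01 p1.
Let p0 : 0 < p. Proof. exact: lt_le_trans p1. Qed.
Local Notation T := (measurableTypeR R).

Definition haar_Lfun n : L := Lfun_Sub pE (haar_fun_Lfun p1 n).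

Lemma haar_classE n : haar_class p1 n = \pi_X (haar_Lfun n). Proof. by []. Qed.

(** Outside the null set complementary to [[0, 1[], the Haar sum takes the value
    [node_value b m j] on the [j]-th dyadic interval of length [2^-m]. *)
Lemma norm_haar_sum (b : nat -> R) m :
  `|lincomb (haar_class p1) b (2 ^ m)| `^ p = level_avg m (fun j => `|node_value b m j| `^ p).
Proof.
pose f : L := \sum_(i < 2 ^ m) b i *: haar_Lfun i.
have -> : lincomb (haar_class p1) b (2 ^ m) = \pi_X f.
  by rewrite /f raddf_sum /=; apply: eq_bigr => i _; rewrite Lp_piZ.
apply: EFin_inj; rewrite (@Lp_norm_powR _ _ _ mu p p1 f).
have fE x : f x = \sum_(0 <= i < 2 ^ m) b i * @haar_fun R i x.
  by rewrite /f Lfun_sumE big_mkord.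
have mdy j := @measurable_dyad R m j.
pose G (j : nat) (x : T) : \bar R := (`|node_value b m j| `^ p * \1_(dyad m j) x)%:E.
have mG j : measurable_fun setT (G j).
  by apply/measurable_EFinP; apply: measurable_funM => //; exact: measurable_indic.
have G0 j x : (0 <= G j x)%E by rewrite lee_fin mulr_ge0 ?powR_ge0.
rewrite (ge0_ae_eq_integral (g := fun x => \sum_(j <- iota 0 (2 ^ m)) G j x)%E) //.
- rewrite ge0_integral_sum// /level_avg mulr_sumr.
  rewrite /index_iota subn0 -sumEFin big_seq [RHS]big_seq; apply: eq_bigr => j.
  rewrite mem_iota add0n => /andP[_ jm].
  under eq_integral do rewrite /G EFinM.
  have mI : measurable_fun setT (EFin \o (\1_(dyad m j) : T -> R)).
    by apply/measurable_EFinP; exact: measurable_indic.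
  rewrite ge0_integralZl//.
  rewrite integral_indic// setIT.
  transitivity ((`|node_value b m j| `^ p)%:E * ((2 ^+ m)^-1)%:E)%E; last by rewrite -EFinM mulrC.
  by congr (_ * _)%E; exact: lebesgue01_dyad.
- exact: measurable_powR_norm.
- exact: emeasurable_sum.
- by move=> x _; rewrite sume_ge0.
exists (~` `[0 : R, 1[%classic); split.
- by apply: measurableC; exact: measurable_itv.
- apply: lebesgue01_null; first by apply: measurableC; exact: measurable_itv.
  by rewrite setICl.
move=> x /=; apply: contra_not.
rewrite in_itv/= => x01 _; have [j jm xj] := @dyad_exists R m x x01.
rewrite fE (haar_sum_dyad b jm xj) sumEFin; congr EFin.
rewrite (bigD1_seq j) ?mem_iota ?iota_uniq//= (indic_dyad _ xj) eqxx mulr1 big1 ?addr0// => i ij.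
by rewrite (indic_dyad _ xj) (negbTE ij) mulr0.
Qed.

Lemma norm_haar_class n : `|haar_class p1 n| = (haar_scale p n)^-1.
Proof.
have nm : (n < 2 ^ n)%N by rewrite ltn_expl.
have := norm_haar_sum (fun k => (k == n)%:R) n.
rewrite level_avg_delta// /lincomb (bigD1 (Ordinal nm))//= eqxx scale1r.
rewrite big1 ?addr0 => [|k /eqP kn]; last first.
  rewrite (_ : (k == n :> nat) = false) ?scale0r//.
  by apply/eqP => E; apply: kn; exact: val_inj.
move=> E; have : (`|haar_class p1 n| `^ p) `^ p^-1 = ((inv_len R n)^-1) `^ p^-1 by rewrite E.
rewrite -powRrM mulfV ?gt_eqF// powRr1// => ->.
by rewrite /haar_scale -powR_inv1 ?(ltW (inv_len_gt0 _ _))// -powRrM mulN1r powRN.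
Qed.

Lemma haarE n : haar p1 n = haar_scale p n *: haar_class p1 n.
Proof. by rewrite /haar norm_haar_class invrK. Qed.

Lemma lincomb_haar b n :
  lincomb (haar p1) b n = lincomb (haar_class p1) (fun i => haar_scale p i * b i) n.
Proof. by apply: eq_bigr => i _; rewrite haarE scalerA mulrC. Qed.

Lemma norm_lincomb_haar b m :
  `|lincomb (haar p1) b (2 ^ m)| `^ p =
  level_avg m (fun j => `|node_value (fun i => haar_scale p i * b i) m j| `^ p).
Proof. by rewrite lincomb_haar norm_haar_sum. Qed.

Local Notation V := (span_closure (haar p1)).

Lemma haar_class_closure n : V (haar_class p1 n).
Proof.
have -> : haar_class p1 n = (haar_scale p n)^-1 *: haar p1 n.
  by rewrite haarE scalerA mulVf ?scale1r// gt_eqF// haar_scale_gt0.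
exact/span_closureZ/span_closure_gen.
Qed.

Local Notation indX mA := (\pi_X (@indic_Lfun _ _ _ mu p p1 _ mA)).

Lemma indX_ext (A B : set T) (mA : measurable A) (mB : measurable B) :
  A = B -> indX mA = indX mB.
Proof. by move=> AB; congr (\pi_X _); apply/LfuneqP => x; rewrite !indic_LfunE AB. Qed.

Lemma norm_indX (A : set T) (mA : measurable A) : (`|indX mA| `^ p)%:E = mu A.
Proof. exact: norm_indic_Lfun. Qed.

Lemma indX_null (A : set T) (mA : measurable A) : mu A = 0%E -> indX mA = 0.
Proof.
move=> A0; have := norm_indX mA; rewrite A0 => -[] /powR_eq0_eq0 /eqP.
by rewrite normr_eq0 => /eqP.
Qed.

Lemma indXU (A B C : set T) (mA : measurable A) (mB : measurable B) (mC : measurable C) :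
  (forall x, \1_C x = \1_A x + \1_B x :> R) -> indX mC = indX mA + indX mB.
Proof.
move=> h; rewrite -raddfD /=; congr (\pi_X _); apply/LfuneqP => x.
by rewrite LfunDE !indic_LfunE h.
Qed.

Lemma indXD (A B C : set T) (mA : measurable A) (mB : measurable B) (mC : measurable C) :
  A `<=` B -> C = B `\` A -> indX mC = indX mB - indX mA.
Proof.
move=> AB CE; suff -> : indX mB = indX mA + indX mC by rewrite addrC addKr.
apply: indXU => x; rewrite CE !indicE in_setD.
have [/set_mem/AB xB|xA] := boolP (x \in A); first by rewrite mem_set// andbF addr0.
by rewrite andbT add0r.
Qed.

Lemma indXT : indX measurableT = haar_class p1 0.
Proof. by congr (\pi_X _); apply/LfuneqP => x; rewrite indic_LfunE indicT. Qed.

(** The sum of the indicators of the two halves of a dyadic interval is the indicator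
    of that interval and their difference is a Haar function, so both halves are
    reached by induction on the generation. *)
Lemma closure_dyad m j : (j < 2 ^ m)%N -> V (indX (@measurable_dyad R m j)).
Proof.
elim: m j => [|m IH] j.
  rewrite expn0 ltnS leqn0 => /eqP ->.
  have m01 := @measurable_dyad R 0 0.
  have -> : indX (@measurable_dyad R 0 0) = indX measurableT - indX (measurableC m01).
    apply/eqP; rewrite eq_sym subr_eq; apply/eqP; apply: indXU => x.
    by rewrite !indicE in_setT in_setC; case: (x \in _); rewrite /= ?addr0 ?add0r.
  have -> : indX (measurableC m01) = 0.
    apply: indX_null; apply: lebesgue01_null; first exact: measurableC.
    by rewrite /dyad expr0 !divr1 setICl.
  by rewrite subr0 indXT; exact: haar_class_closure.
move=> jm; have jm2 : (j./2 < 2 ^ m)%N by move: jm; rewrite expnS; lia.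
pose A := indX (@measurable_dyad R m.+1 j./2.*2).
pose B := indX (@measurable_dyad R m.+1 j./2.*2.+1).
have AB : indX (@measurable_dyad R m j./2) = A + B by apply: indXU => x; exact: indic_dyad_split.
have AB' : haar_class p1 (2 ^ m + j./2)%N = A - B.
  rewrite haar_classE -raddfB /=; congr (\pi_X _); apply/LfuneqP => x.
  by rewrite LfunBE !indic_LfunE -haar_fun_node.
have VAB := IH _ jm2; have VAB' := haar_class_closure (2 ^ m + j./2)%N.
rewrite AB in VAB; rewrite AB' in VAB'.
have VA : V A.
  have -> : A = 2^-1 *: ((A + B) + (A - B)).
    have -> : A + B + (A - B) = 2 *: A by rewrite addrACA subrr addr0 scaler_nat mulr2n.
    by rewrite scalerA mulVf// scale1r.
  exact/span_closureZ/span_closureD.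
have VB : V B.
  have -> : B = (A + B) - A by rewrite addrC addKr.
  exact: span_closureB.
rewrite -(odd_double_half j); case: (odd j) => /=; [exact: VB|exact: VA].
Qed.

Lemma closure_dyadic_ray m k : (k <= 2 ^ m)%N ->
  V (indX (measurable_itv `[0 : R, k%:R / 2 ^+ m[)).
Proof.
have m0 : 0 < 2 ^+ m :> R by rewrite exprn_gt0.
elim: k => [_|k IH km].
  rewrite indX_null; last by rewrite mul0r set_itvco0 measure0.
  by rewrite -(scale0r (haar_class p1 0)); exact/span_closureZ/haar_class_closure.
rewrite (indXU (measurable_itv `[0 : R, k%:R / 2 ^+ m[) (@measurable_dyad R m k)).
  by apply: span_closureD; [apply: IH; exact: ltnW|exact: closure_dyad].
have k0 : 0 <= k%:R / 2 ^+ m :> R by rewrite divr_ge0// ltW.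
have kk : k%:R / 2 ^+ m < k.+1%:R / 2 ^+ m :> R by rewrite ltr_pM2r ?invr_gt0// ltr_nat.
move=> x; rewrite !indicE /dyad !mem_setE /= !in_itv /=.
case: (ltP x (k%:R / 2 ^+ m)) => h; rewrite ?andbT ?andbF /= ?addr0 ?add0r.
  by rewrite (lt_trans h kk) andbT.
by rewrite (le_trans k0 h).
Qed.

Lemma powR_lt_inv (x y : R) : 0 <= x -> 0 < y -> x `^ p < y `^ p -> x < y.
Proof.
move=> x0 y0; rewrite !ltNge; apply: contra => yx.
by apply: ge0_ler_powR; rewrite ?nnegrE// ltW.
Qed.

(** The ray differs, inside [[0, 1]], from a union of consecutive dyadic intervals by part
    of a single dyadic interval. *)
Lemma closure_ray (t : R) : V (indX (measurable_itv `]-oo, t])).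
Proof.
apply: span_closure_lim => eta eta0.
have ep0 : 0 < eta `^ p by exact: powR_gt0.
(* [m] makes a dyadic interval of generation [m] shorter than [eta `^ p] *)
pose m := Num.truncn ((eta `^ p)^-1).
have m0 : 0 < 2 ^+ m :> R by rewrite exprn_gt0.
have hm : (2 ^+ m)^-1 < eta `^ p.
  rewrite -[ltRHS]invrK ltf_pV2 ?posrE ?invr_gt0//.
  by rewrite (lt_le_trans (truncnS_gt _))// -natrX ler_nat ltn_expl.
(* the number of intervals of generation [m] inside [[0, 1]] contained in the ray *)
pose k := minn (Num.truncn (t * 2 ^+ m)) (2 ^ m).
have km : (k <= 2 ^ m)%N by rewrite geq_minr.
have mA := measurable_itv `]-oo, t]; have mB := measurable_itv `[0 : R, k%:R / 2 ^+ m[.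
have kt : (0 < k)%N -> k%:R <= t * 2 ^+ m.
  by move=> k0; rewrite -(prednK k0) -truncn_gt_nat prednK// geq_minl.
have BA : [set` `[0 : R, k%:R / 2 ^+ m[] `<=` [set` `]-oo, t]].
  move=> x /=; rewrite !in_itv/= => /andP[x0]; rewrite ltr_pdivlMr// => xk.
  rewrite -(ler_pM2r m0) ltW// (lt_le_trans xk)// kt//.
  by rewrite -(ltr_nat R) (le_lt_trans _ xk)// mulr_ge0// ltW.
exists (indX mB); first by have := closure_dyadic_ray km; rewrite (indX_ext _ mB erefl).
rewrite (indX_ext _ mA erefl) -(indXD mB mA (measurableD mA mB) BA erefl);
  apply: powR_lt_inv => //.
rewrite -lte_fin norm_indX; apply: (@le_lt_trans _ _ ((2 ^+ m)^-1)%:E); last by rewrite lte_fin.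
have <- : lebesgue_measure (`[k%:R / 2 ^+ m, k.+1%:R / 2 ^+ m]%classic : set R) =
    ((2 ^+ m)^-1)%:E.
  rewrite lebesgue_measure_itv /= lte_fin ltr_pM2r ?invr_gt0// ltr_nat ltnSn.
  by rewrite -EFinB -mulrBl -natrB// subSnn mul1r.
rewrite /lebesgue01 /mrestr; apply: le_measure.
- by rewrite inE; apply: measurableI; [exact: measurableD|exact: measurable_itv].
- by rewrite inE; exact: measurable_itv.
move=> x [[/= +]]; rewrite !in_itv/= => xt xB /andP[x0 x1].
have kx : k%:R / 2 ^+ m <= x.
  by rewrite leNgt; apply/negP => xk; apply: xB; rewrite x0.
rewrite kx/= ler_pdivlMr//.
have [h|h] := leqP (Num.truncn (t * 2 ^+ m)) (2 ^ m).
  rewrite /k (minn_idPl h); apply/ltW; apply: le_lt_trans (truncnS_gt _).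
  by rewrite ler_pM2r.
rewrite /k (minn_idPr (ltnW h)) -[leRHS]natr1 natrX ler_wpDr//.
by rewrite -[leRHS]mul1r ler_pM2r.
Qed.

(** Dynkin's theorem with the half-open intervals, which are differences of rays, as
    generating class; the remainders of a disjoint union decrease to the empty set,
    so their measures tend to zero. *)
Lemma closure_ind (A : set T) (mA : measurable A) : V (indX mA).
Proof.
have VT : V (indX measurableT) by rewrite indXT; exact: haar_class_closure.
pose P (A : set T) := forall mA : measurable A, V (indX mA).
suff : P A by exact.
apply: (@dynkin_induction _ T (R.-ocitv.-measurable) P) => //.
- exact: ocitvI.
- by move=> m; rewrite (indX_ext _ measurableT erefl).
- move=> _ [[a b] _ <-] /= mab.
  have [ab|ba] := leP a b; last first.
    have e0 : `]a, b]%classic = set0.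
      rewrite -subset0 => y /=; rewrite in_itv/= => /andP[ay yb].
      by have := lt_trans ba (lt_le_trans ay yb); rewrite ltxx.
    rewrite indX_null; last by rewrite e0 measure0.
    by rewrite -(scale0r (haar_class p1 0)); exact/span_closureZ/haar_class_closure.
  have sub : [set` `]-oo, a]] `<=` [set` `]-oo, b]].
    by move=> x /=; rewrite !in_itv/= => /le_trans; apply.
  rewrite (indXD (measurable_itv `]-oo, a]) (measurable_itv `]-oo, b]) mab sub).
    by apply: span_closureB; exact: closure_ray.
  apply/seteqP; split=> x /=; rewrite !in_itv/=.
    by move=> /andP[ax xb]; split => //; apply/negP; rewrite -ltNge.
  by move=> [xb /negP]; rewrite -ltNge => ->.
- move=> S mS PS mC; rewrite (indXD mS measurableT mC) ?setTD//.
  by apply: span_closureB => //; exact: PS.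
- move=> F mF tF PF mU.
  apply: span_closure_lim => eta eta0.
  have ep0 : 0 < eta `^ p by exact: powR_gt0.
  have FU n : (\big[setU/set0]_(k < n) F k) `<=` \bigcup_k F k.
    by rewrite -bigcup_mkord => x [k _ Fk]; exists k.
  have mUn n : measurable (\big[setU/set0]_(k < n) F k) by exact: bigsetU_measurable.
  have mU' : measurable (\bigcup_k F k) by exact: bigcup_measurable.
  pose D n := (\bigcup_k F k) `\` (\big[setU/set0]_(k < n) F k).
  have mD n : measurable (D n) by exact: measurableD.
  have D0 : \bigcap_n D n = set0.
    rewrite -subset0 => x Dx; have [[k _ Fkx] _] := Dx 0%N I.
    have [_] := Dx k.+1 I; apply; rewrite -bigcup_mkord; exists k => //=.
  have dD : nonincreasing_seq D.
    apply/nonincreasing_seqP => n; apply/subsetPset => x [Ux nx]; split=> // nx'.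
    by apply: nx; rewrite big_ord_recr; left.
  have : mu \o D @ \oo --> mu (\bigcap_n D n).
    apply: nonincreasing_cvg_mu => //; last by rewrite D0.
    by rewrite -ge0_fin_numE// fin_num_measure.
  rewrite D0 measure0 => /fine_cvgP[_ /cvgrPdist_lt /(_ _ ep0)[n _ /(_ n (leqnn _))]] /=.
  rewrite sub0r normrN ger0_norm ?fine_ge0// => hn.
  have sumE k : indX (mUn k) = \sum_(i < k) indX (mF i).
    elim: k => [|k IH].
      by rewrite [RHS]big_ord0; apply: indX_null; rewrite big_ord0 measure0.
    rewrite [RHS]big_ord_recr -IH /=; apply: indXU => x.
    rewrite !indicE big_ord_recr /= in_setU.
    have [xF|xF] := boolP (x \in F k); rewrite ?orbT ?orbF ?addr0//.
    rewrite (_ : (x \in _) = false) ?add0r//; apply/negbTE/negP.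
    rewrite inE -bigcup_mkord => -[i /= ik Fi]; move: xF; rewrite inE => Fk.
    have := tF i k I I; have : (F i `&` F k) !=set0 by exists x.
    by move=> h /(_ h) E; move: ik; rewrite E ltnn.
  exists (indX (mUn n)).
    rewrite sumE; elim/big_ind : _ => //; last by move=> i _; exact: PF.
      by rewrite -(scale0r (haar_class p1 0)); exact/span_closureZ/haar_class_closure.
    exact: span_closureD.
  rewrite -(indXD (mUn n) mU (mD n) (FU n) erefl); apply: powR_lt_inv => //.
  rewrite -lte_fin norm_indX; move: hn; rewrite -lte_fin fineK//.
  by rewrite fin_num_measure.
Qed.

Lemma haar_dense x : V x.
Proof.
apply: (@closed_subspace_full _ _ _ mu p p1 V).
- exact: span_closureD.
- exact: span_closureZ.
- exact: span_closure_lim.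
- exact: closure_ind.
Qed.

(** The tree describes sums over [2^n] indices; shorter sums are padded by zeros. *)
Lemma lincomb_pad (e : nat -> X) b n :
  lincomb e b n = lincomb e (fun i => b i * (i < n)%N%:R) (2 ^ n).
Proof.
rewrite (@lincomb_trunc _ _ _ _ n) ?(ltnW (ltn_expl _ _))//.
  by apply: eq_lincomb => i ->; rewrite mulr1.
by move=> i; rewrite leqNgt => /negbTE ->; rewrite mulr0.
Qed.

Lemma le_root (x y c : R) : 0 <= x -> 0 <= y -> 0 <= c -> x `^ p <= c * y `^ p ->
  x <= c `^ p^-1 * y.
Proof.
move=> x0 y0 c0 h; have ip0 : 0 <= p^-1 by rewrite invr_ge0 ltW.
have := ge0_ler_powR ip0 _ _ h; rewrite !nnegrE powR_ge0 mulr_ge0 ?powR_ge0//.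
by move=> /(_ isT isT); rewrite powRM ?powR_ge0// -!powRrM mulfV ?gt_eqF// !powRr1.
Qed.

Lemma haar_upper (A : {fset nat}) (b : nat -> R) : (forall i, `|b i| <= 1) ->
  `|\sum_(i <- A) b i *: haar p1 i| <= (upper_const p) `^ p^-1 * #|` A|%:R `^ p^-1.
Proof.
move=> b1; have [n An] := fset_bounded A.
have An2 i : i \in A -> (i < 2 ^ n)%N.
  by move=> /An h; rewrite (leq_trans h)// ltnW// ltn_expl.
rewrite -(sum_fset_all _ An2) -lincomb_fset -powRM ?upper_const_ge0//.
apply: (@le_trans _ _
  ((`|lincomb (haar p1) (fun i => b i * (i \in A)%:R) (2 ^ n)| `^ p) `^ p^-1)).
  by rewrite -powRrM mulfV ?gt_eqF// powRr1.
apply: ge0_ler_powR; rewrite ?nnegrE ?powR_ge0 ?mulr_ge0 ?upper_const_ge0 ?invr_ge0 ?(ltW p0)//.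
rewrite norm_lincomb_haar; apply: le_trans (level_avg_upper (A := fun i => i \in A) p1 _ _) _.
  move=> i; rewrite normrM gtr0_norm ?haar_scale_gt0// ler_wpM2l ?(ltW (haar_scale_gt0 _ _))//.
  by rewrite normrM normr_nat ler_piMl.
rewrite ler_wpM2l ?upper_const_ge0// big_mkord.
rewrite (eq_bigr (fun i : 'I_(2 ^ n) => if val i \in A then 1 else 0 : R)) => [|i _];
  last by case: ifP.
rewrite -big_mkcond (sum_fset_ltn A (fun=> 1 : R)) (sum_fset_all _ An2).
by have := @ler_sum_card R A (fun=> 1) 1 (fun _ _ => lexx _); rewrite mul1r.
Qed.

Lemma haar_signs n (s b : nat -> R) : 1 < p -> (forall i, s i = 1 \/ s i = -1) ->
  `|lincomb (haar p1) (fun i => s i * b i) n| <=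
  (transform_const p (p - 1 + (p - 1)^-1)) `^ p^-1 * `|lincomb (haar p1) b n|.
Proof.
move=> p1' hs; have pm : 0 < p - 1 by rewrite subr_gt0.
(* an upper bound of both [p - 1] and [(p - 1)^-1], the two cases of the slope condition *)
set beta := p - 1 + (p - 1)^-1.
have bp : p - 1 <= beta by rewrite lerDl invr_ge0 ltW.
have bq : 1 <= beta * (p - 1).
  by rewrite mulrDl mulVf ?gt_eqF// lerDr mulr_ge0// ltW.
have b1 : 1 <= beta.
  have [h|h] := leP 2 p; first by apply: le_trans bp; lra.
  apply: le_trans bq _; rewrite ler_piMr//; last lra.
  by apply: le_trans bp; exact: ltW.
have hb : (beta + 1) * `|p - 2| <= (beta - 1) * p.
  have [h|h] := leP 2 p.
    by rewrite ger0_norm ?subr_ge0//; move: bp; lra.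
  by rewrite ltr0_norm ?subr_lt0//; move: bq; lra.
have z0 : 0 <= transform_const p beta.
  by rewrite /transform_const addr_ge0 ?powR_ge0// !mulr_ge0 ?powR_ge0//; lra.
apply: le_root => //; rewrite [in leRHS]lincomb_pad lincomb_pad !norm_lincomb_haar.
have := sign_transform_le p1' hb b1 (fun i => haar_scale p i * (b i * (i < n)%N%:R)) hs n.
apply: le_trans; rewrite le_eqVlt; apply/orP; left; apply/eqP.
congr (level_avg _ _); apply/funext => j; congr (`|node_value _ _ _| `^ _).
by apply/funext => i; ring.
Qed.

Lemma haar_lower (q : R) n (A : {fset nat}) (b : nat -> R) : 1 < p -> 1 < q -> p^-1 + q^-1 = 1 ->
  \sum_(i <- A | (i < n)%N) `|b i| <=
  (upper_const q) `^ q^-1 * #|` A|%:R `^ q^-1 * `|lincomb (haar p1) b n|.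
Proof.
move=> p1' q1 pq.
have n2 : (n <= 2 ^ n)%N by rewrite ltnW// ltn_expl.
rewrite lincomb_pad; set c := fun i => b i * (i < n)%N%:R.
pose B : pred nat := fun i => i \in A.
have := @level_avg_lower R p q B c n p1' q1 pq.
rewrite -norm_lincomb_haar -powRrM mulfV ?gt_eqF// powRr1// => h.
have -> : \sum_(i <- A | (i < n)%N) `|b i| = \sum_(0 <= i < 2 ^ n) `|c i| * (B i)%:R.
  rewrite -sum_fset_ltn -(big_mkord (fun i => i \in A) (fun i => `|b i|)).
  rewrite [RHS](@big_cat_nat _ _ _ n)//= [X in _ = _ + X]big_nat_cond.
  rewrite [X in _ = _ + X]big1 => [|i]; last first.
    by rewrite andbT /c => /andP[/leq_gtF -> _]; rewrite mulr0 normr0 mul0r.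
  rewrite addr0 big_mkcond; apply: eq_big_nat => i /andP[_ i_n].
  by rewrite /c /B i_n mulr1; case: ifP => _; rewrite ?mulr1 ?mulr0.
apply: le_trans h _; rewrite mulrC ler_wpM2r//.
have q0 : 0 < q by rewrite (lt_trans ltr01).
rewrite -powRM ?upper_const_ge0//; apply: ge0_ler_powR.
- by rewrite invr_ge0 ltW.
- by rewrite nnegrE mulr_ge0 ?upper_const_ge0// sumr_ge0.
- by rewrite nnegrE mulr_ge0 ?upper_const_ge0.
rewrite ler_wpM2l ?upper_const_ge0// big_mkord.
rewrite (eq_bigr (fun i : 'I_(2 ^ n) => if val i \in A then 1 else 0 : R)) => [|i _]; last first.
  by rewrite /B; case: ifP.
rewrite -big_mkcond (sum_fset_ltn A (fun=> 1 : R)).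
have := @ler_sum_card R A (fun=> 1) 1 (fun _ _ => lexx _); rewrite mul1r; apply: le_trans.
by rewrite big_mkcond; apply: ler_sum => i _; case: ifP.
Qed.

End haar_Lp.

Theorem corollary5 (R : realType) (p : R) (hp : 1 < p) (eps : R) (heps : 0 < eps) :
  exists N : Lp01 (ltW hp) -> R,
    equivalent_norm N /\
    schauder_basis N (haar (ltW hp)) /\
    normalized N (haar (ltW hp)) /\
    unconditional 1 N (haar (ltW hp)) /\
    bidemocratic 1 N (haar (ltW hp)) /\
    greedy (1 + eps) N (haar (ltW hp)).
Proof.
have p0 : 0 < p by rewrite (lt_trans ltr01).
pose q := p / (p - 1).
have pm : 0 < p - 1 by rewrite subr_gt0.
have q1 : 1 < q by rewrite ltr_pdivlMr// mul1r ltrBlDr ltrDl.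
have q0 : 0 < q by rewrite (lt_trans ltr01).
have pq : p^-1 + q^-1 = 1 by rewrite /q; field; rewrite !gt_eqF.
pose C := upper_const p `^ p^-1 + upper_const q `^ q^-1.
have Cp : upper_const p `^ p^-1 <= C by rewrite lerDl; exact: powR_ge0.
have Cq : upper_const q `^ q^-1 <= C by rewrite lerDr; exact: powR_ge0.
apply: (@bidemocratic_renorming R (Lp01 (ltW hp)) (haar (ltW hp)) p q
  (transform_const p (p - 1 + (p - 1)^-1) `^ p^-1) C p0 q0 pq) => //.
- exact: powR_ge0.
- by apply: le_trans Cp; exact: powR_ge0.
- move=> n a b ab; apply: multiplier_of_signs => // m s c hs.
  exact: haar_signs.
- move=> x eta eta0; exact: haar_dense.
- by move=> A b b1; apply: le_trans (haar_upper _ _ b1) (ler_wpM2r (powR_ge0 _ _) Cp).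
- move=> n A b; apply: le_trans (@haar_lower R p (ltW hp) q n A b hp q1 pq) _.
    apply: ler_wpM2r; first exact: normr_ge0.
  exact: (ler_wpM2r (powR_ge0 _ _) Cq).
Qed.
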